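(* For any compactly supported probability measure $\mu_D$ on $\mathbb{R}$ and any $t>0$, let $\mu_t=\rho_{\mathrm{sc},t}\boxplus\mu_D$, with density $\mu_t(\cdot)$ and left edge $\ell_t$. Then there exist $c,\epsilon>0$ such that $$\mu_t(x)\le c\sqrt{x-\ell_t}\qquad\text{for all }x\in[\ell_t,\ell_t+\epsilon].$$
   Context: $\rho_{\mathrm{sc},t}(dx)=\frac{\sqrt{4t-x^2}}{2\pi t}\mathbf{1}_{|x|\le2\sqrt t}\,dx$ is the semicircle law of variance $t$; $\boxplus$ is free additive convolution; the left edge of a compactly supported measure is the minimum of its support. $\mu_t$ has a continuous density with respect to Lebesgue measure. *)

(* Defs.v *)
From HB Require Import structures.
From mathcomp Require Import all_boot all_order all_algebra.
From mathcomp Require Import all_classical all_reals all_analysis.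
From mathcomp Require Import measurable_realfun ring lra.

Set Implicit Arguments.
Unset Strict Implicit.
Unset Printing Implicit Defensive.

Import Order.TTheory GRing.Theory Num.Theory.
Import numFieldNormedType.Exports.

Local Open Scope classical_set_scope.
Local Open Scope ring_scope.

Definition msupport (R : realType) (mu : probability R R) : set R :=
  [set x | forall U : set R, open U -> U x -> (0 < mu U)%E].

Definition left_edge (R : realType) (mu : probability R R) : R :=
  inf (msupport mu).

Definition right_edge (R : realType) (mu : probability R R) : R :=
  sup (msupport mu).

Definition has_density (R : realType) (mu : probability R R) (f : R -> R) :=
  measurable_fun [set: R] f /\ (forall x, 0 <= f x) /\
  forall A : set R, measurable A ->
    mu A = (\int[lebesgue_measure]_(x in A) (f x)%:E)%E.

Section semicircle.
Context (R : realType) (t : R).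

Definition semicircle_pdf (x : R) : R :=
  if `|x| <= 2 * Num.sqrt t
  then Num.sqrt (4 * t - x ^+ 2) / (2 * pi * t) else 0.

Lemma semicircle_pdfE : 0 < t ->
  semicircle_pdf = (fun x => Num.sqrt (4 * t - x ^+ 2) / (2 * pi * t)).
Proof.
move=> t0; apply/funext => x; rewrite /semicircle_pdf.
case: ifPn => //; rewrite -ltNge => tx; rewrite ler0_sqrtr ?mul0r//.
have st := sqr_sqrtr (ltW t0); have s0 := sqrtr_ge0 t.
rewrite -(real_normK (num_real x)) -st.
move: tx s0; set a := `|x|; set s := Num.sqrt t => tx s0; nra.
Qed.

Lemma semicircle_pdf_ge0 x : 0 < t -> 0 <= semicircle_pdf x.
Proof.
move=> t0; rewrite semicircle_pdfE// divr_ge0 ?sqrtr_ge0//.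
by rewrite !mulr_ge0// ?pi_ge0// ltW.
Qed.

Lemma continuous_semicircle_pdf : 0 < t -> continuous semicircle_pdf.
Proof.
move=> t0 x; rewrite semicircle_pdfE//.
apply: cvgMr_tmp.
apply: (@cvg_comp _ _ _ (fun x => 4 * t - x ^+ 2) Num.sqrt).
  by apply: cvgB; [exact: cvg_cst|exact: exprn_continuous].
exact: sqrt_continuous.
Qed.

Lemma measurable_semicircle_pdf :
  0 < t -> measurable_fun [set: R] semicircle_pdf.
Proof.
by move=> t0; apply: continuous_measurable_fun; exact: continuous_semicircle_pdf.
Qed.

Lemma integral_semicircle_pdf : 0 < t ->
  (\int[lebesgue_measure]_x (semicircle_pdf x)%:E = 1)%E.
Proof.
move=> t0; pose s := Num.sqrt t.
have s0 : 0 < s by rewrite sqrtr_gt0.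
have s2 : s ^+ 2 = t by exact: sqr_sqrtr (ltW t0).
have p0 : 0 < pi :> R := pi_gt0 R.
pose F : R -> R := fun x => 2 * s * sin x.
have dF (x : R) : is_derive x (1 : R) F (2 * s * cos x).
  by rewrite /F; apply: is_derive_eq.
have F'E : derive1 F = (fun x => 2 * s * cos x).
  by apply/funext => x; rewrite derive1E derive_val.
have cF' : continuous (fun x : R => 2 * s * cos x).
  by move=> x; apply: cvgMl_tmp; exact: continuous_cos.
have cF : continuous F by move=> x; apply: cvgMl_tmp; exact: continuous_sin.
have Fa : F (- (pi / 2)) = - (2 * s) by rewrite /F sinN sin_pihalf mulrN1.
have Fb : F (pi / 2) = 2 * s by rewrite /F sin_pihalf mulr1.
pose a : R := - (pi / 2); pose b : R := pi / 2.
transitivity (\int[lebesgue_measure]_(x in `[F a, F b])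
    (semicircle_pdf x)%:E)%E.
  rewrite /a /b Fa Fb [RHS]integral_mkcond; apply: eq_integral => x _.
  rewrite patchE; case: ifPn => //; rewrite notin_setE/= in_itv/= => /negP.
  by rewrite -ler_norml /semicircle_pdf => /negbTE ->.
have ab : a < b by rewrite /a /b; lra.
rewrite integration_by_substitution_increasing; last 7 first.
- exact: ltW.
- move=> x y; rewrite !in_itv/= => xi yi xy; rewrite /F ltr_pM2l ?mulr_gt0//.
  by rewrite ltr_sin// in_itv.
- by rewrite F'E => x _; exact: cF'.
- by rewrite F'E; apply/cvg_ex; eexists; apply: cvg_at_right_filter; exact: cF'.
- by rewrite F'E; apply/cvg_ex; eexists; apply: cvg_at_left_filter; exact: cF'.
- split; first by move=> x _; exact: ex_derive.
    by apply: cvg_at_right_filter; exact: cF.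
  by apply: cvg_at_left_filter; exact: cF.
- by apply: continuous_subspaceT; exact: continuous_semicircle_pdf.
pose g : R -> R := fun x => 2 / pi * cos x ^+ 2.
pose G : R -> R := fun x => (x + sin x * cos x) / pi.
have dG (x : R) : is_derive x (1 : R) G (g x).
  rewrite /G; apply: is_derive_eq.
  rewrite /g /GRing.scale/= mulr0 add0r mulrN -!expr2 sin2cos2.
  by move: (pi^-1 : R) (cos x) => p c; ring.
transitivity (\int[lebesgue_measure]_(x in `[a, b]) (g x)%:E)%E.
  apply: eq_integral => x; rewrite inE/= in_itv/= => xi; congr (_%:E).
  change (semicircle_pdf (F x) * derive1 F x = g x).
  rewrite F'E semicircle_pdfE//= /F.
  have -> : 4 * t - (2 * s * sin x) ^+ 2 = (2 * s * cos x) ^+ 2.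
    by rewrite -s2 !exprMn cos2sin2; ring.
  rewrite sqrtr_sqr ger0_norm; last first.
    by rewrite mulr_ge0 ?cos_ge0_pihalf// mulr_ge0// ltW.
  rewrite /g -s2.
  move: (pi : R) p0 (cos x) => p p0' c; field.
  by rewrite !gt_eqF.
rewrite (@continuous_FTC2 _ _ G)//.
- rewrite /G /a /b cosN cos_pihalf !mulr0 !addr0 -EFinB; congr (_%:E).
  rewrite /a /b; move: (pi : R) p0 => p p0'; field.
  by rewrite gt_eqF.
- apply: continuous_subspaceT => x; apply: cvgMl_tmp.
  apply: (@cvg_comp _ _ _ cos (fun x => x ^+ 2)); first exact: continuous_cos.
  exact: exprn_continuous.
- have cG : continuous G.
    by move=> x; apply/differentiable_continuous/derivable1_diffP; exact: ex_derive.
  split; first by move=> x _; exact: ex_derive.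
    by apply: cvg_at_right_filter; exact: cG.
  by apply: cvg_at_left_filter; exact: cG.
- by move=> x _; rewrite derive1E derive_val.
Qed.

Definition semicircle_law (t0 : 0 < t) : set R -> \bar R :=
  fun A => (\int[lebesgue_measure]_(x in A) (semicircle_pdf x)%:E)%E.

Context (t0 : 0 < t).

Let semicircle_law0 : semicircle_law t0 set0 = 0%E.
Proof. by rewrite /semicircle_law integral_set0. Qed.

Let semicircle_law_ge0 A : (0 <= semicircle_law t0 A)%E.
Proof. by apply: integral_ge0 => x _; rewrite lee_fin semicircle_pdf_ge0. Qed.

Let semicircle_law_sigma_additive : semi_sigma_additive (semicircle_law t0).
Proof.
move=> /= F mF tF mUF; rewrite /semicircle_law; apply: cvg_toP.
  apply: ereal_nondecreasing_is_cvgn => m n mn.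
  apply: lee_sum_nneg_natr => // k _ _.
  by apply: integral_ge0 => /= x _; rewrite lee_fin semicircle_pdf_ge0.
rewrite ge0_integral_bigcup//=.
- apply: measurable_funTS; apply: measurableT_comp => //.
  exact: measurable_semicircle_pdf.
- by move=> x _; rewrite lee_fin semicircle_pdf_ge0.
Qed.

HB.instance Definition _ := isMeasure.Build _ _ _ (semicircle_law t0)
  semicircle_law0 semicircle_law_ge0 semicircle_law_sigma_additive.

Let semicircle_law_setT : semicircle_law t0 [set: R] = 1%E.
Proof. by rewrite /semicircle_law integral_semicircle_pdf. Qed.

HB.instance Definition _ := @Measure_isProbability.Build _ _ R
  (semicircle_law t0) semicircle_law_setT.

End semicircle.

Section free_convolution.
Context (R : realType).
Implicit Types mu nu rho : probability R R.

Definition cauchy_transform mu (z : R) : R := \int[mu]_x (z - x)^-1.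

(* Meaningful for mu compactly supported and w <> 0 small: the Cauchy transform
   is strictly decreasing on each of the two half-lines outside the convex hull
   of the support, positive on the right one and negative on the left one, and
   tends to 0 at infinity, so that there is exactly one such z. *)
Definition cauchy_inverse mu (w : R) : R :=
  xget 0 [set z | (z < left_edge mu \/ right_edge mu < z) /\
                  cauchy_transform mu z = w].

Definition R_transform mu (w : R) : R := cauchy_inverse mu w - w^-1.

(* rho is the free additive convolution of mu and nu, for compactly supported mu
   and nu: the unique compactly supported law whose R-transform is the sum of
   those of mu and nu near 0.  The R-transform of a compactly supported law is a
   power series with real coefficients (the free cumulants) converging near 0,
   so real arguments suffice to identify it. *)
Definition is_free_convolution mu nu rho : Prop :=
  compact (msupport rho) /\
  \forall w \near (0 : R)^',
    R_transform rho w = R_transform mu w + R_transform nu w.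

End free_convolution.

(* Main.v *)
From HB Require Import structures.
Require Import Defs.
From mathcomp Require Import all_boot all_order all_algebra.
From mathcomp Require Import all_classical all_reals all_analysis.
From mathcomp Require Import measurable_realfun complex ring lra.

Import Order.TTheory GRing.Theory Num.Theory.
Import numFieldNormedType.Exports.
Import Normc.

Set Implicit Arguments.
Unset Strict Implicit.
Unset Printing Implicit Defensive.

Local Open Scope classical_set_scope.
Local Open Scope ring_scope.
Local Open Scope complex_scope.

(** Let [G] denote Cauchy transforms and put [omega z = z - t * G_t z], where
    [G_t] belongs to the free convolution [mut] of the semicircle law of
    variance [t] with [muD].  Additivity of R-transforms, together with
    [R_sc w = t * w], says that [G_t z = G_D (omega z)] for real [z] near minus
    infinity ([subordination_near_infinity]).  Both sides are analytic as long as
    [z] and [omega z] avoid the two support intervals, so the identity extends to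
    the upper half plane and to the real line left of the support of [mut]
    ([subordination_up], [subordination_left]).  The continuation is elementary:
    it only uses remainders of Taylor expansions with geometric bounds, along
    segments ([taylor_remainders_vanish], [gap_segment]).

    On the half line left of [left_edge mut] the function [omega] is real,
    increasing, and stays left of [left_edge muD] ([omega_real_le_edge]).  Indeed,
    comparing imaginary parts in the subordination identity gives
    [t * int 1 / |omega z - x| ^ 2 dmuD <= 1]; if [omega] entered the support, the
    mass of [muD] around each point it reaches would be quadratically small in
    the radius, and bisection would show that [muD] vanishes near its own left
    edge.

    For [z] above the axis and a real [y] left of the edge, subtracting the two
    equations [z = w + t * G_D w], [y = u + t * G_D u] for [w = omega z],
    [u = omega y] yields
    [z - y = (w - u) * (1 - t * int 1 / ((w - x) * (u - x)) dmuD)].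
    Since [u - x] is negative and bounded on the support, the imaginary part of
    the integral is at least a multiple of [Im w], whence
    [|z - y| >= const * (Im w) ^ 2] ([Im_omega_sqr_le]), whether or not [omega]
    reaches the edge of [muD].  As [z = x + i * eta] approaches [x], [Im w] is at
    least a fixed multiple of any value below the density at [x]
    ([density_le_square_transform]); with [y] tending to the edge this is the
    square root bound. *)

Local Notation Re := (@complex.Re _).
Local Notation Im := (@complex.Im _).

(** * Integrals of complex functions against a probability measure *)

Section modulus.
Context {R : realType}.
Implicit Types z w : R[i].

Lemma normc_ge0 z : 0 <= normc z.
Proof. by case: z => a b; exact: sqrtr_ge0. Qed.

Lemma normc_eq0 z : (normc z == 0) = (z == 0).
Proof.
by apply/eqP/eqP => [|->]; [exact: eq0_normc|exact: normc0].
Qed.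

Lemma normc_gt0 z : (0 < normc z) = (z != 0).
Proof. by rewrite lt_neqAle normc_ge0 andbT eq_sym normc_eq0. Qed.

Lemma normcX z n : normc (z ^+ n) = normc z ^+ n.
Proof.
by elim: n => [|n ih]; rewrite ?expr0 ?normc1// !exprS normcM ih.
Qed.

Lemma normc_real (x : R) : normc x%:C = `|x|.
Proof. by rewrite /= expr0n/= addr0 sqrtr_sqr. Qed.

Lemma le_normcB z w : normc (z - w) <= normc z + normc w.
Proof. by rewrite -(normcN w) le_normcD. Qed.

Lemma ler_normc_subl z w : normc z - normc w <= normc (z + w).
Proof.
by rewrite lerBlDr -{1}(addrK w z) le_normcB.
Qed.

Lemma normc_sum (I : Type) (r : seq I) (P : pred I) (f : I -> R[i]) :
  normc (\sum_(i <- r | P i) f i) <= \sum_(i <- r | P i) normc (f i).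
Proof.
elim/big_rec2 : _ => [|i x y _ xy]; first by rewrite normc0.
by rewrite (le_trans (le_normcD _ _))// lerD2l.
Qed.

Lemma normc_sqrE z : normc z ^+ 2 = Re z ^+ 2 + Im z ^+ 2.
Proof. by case: z => a b; rewrite sqr_sqrtr// addr_ge0// sqr_ge0. Qed.

Lemma normc_Re z : `|Re z| <= normc z.
Proof.
by case: z => a b; rewrite /= -sqrtr_sqr ler_wsqrtr// lerDl sqr_ge0.
Qed.

Lemma normc_Im z : `|Im z| <= normc z.
Proof.
by case: z => a b; rewrite /= -sqrtr_sqr ler_wsqrtr// lerDr sqr_ge0.
Qed.

Lemma normc_le_ReIm z : normc z <= `|Re z| + `|Im z|.
Proof.
case: z => a b /=; rewrite -[leRHS]ger0_norm ?addr_ge0// -sqrtr_sqr.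
rewrite ler_wsqrtr// sqrrD !real_normK ?num_real// lerD2r lerDl.
by rewrite mulrn_wge0// mulr_ge0.
Qed.

Lemma Re_mulc z w : Re (z * w) = Re z * Re w - Im z * Im w.
Proof. by case: z w => [a b] [c d]. Qed.

Lemma Im_mulc z w : Im (z * w) = Re z * Im w + Im z * Re w.
Proof. by case: z w => [a b] [c d]. Qed.

Lemma Im_sub_real z (x : R) : Im (z - x%:C) = Im z.
Proof. by case: z => a b /=; rewrite subr0. Qed.

Lemma Re_invc z : Re z^-1 = Re z * (normc z ^+ 2)^-1.
Proof. by rewrite normc_sqrE; case: z. Qed.

Lemma Im_invc z : Im z^-1 = - (Im z * (normc z ^+ 2)^-1).
Proof. by rewrite normc_sqrE; case: z. Qed.

End modulus.

Section measurable_inverse.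
Context d (T : measurableType d) (R : realType).

(** Writing the inverse of [y] as [y * (y ^+ 2)^-1] reduces to a real power of a
    nonnegative function, and stays valid at zero. *)
Lemma measurable_funV (D : set T) (f : T -> R) :
  measurable_fun D f -> measurable_fun D (fun x => (f x)^-1).
Proof.
move=> mf.
have -> : (fun x => (f x)^-1) = (fun x => f x * powR (f x ^+ 2) (-1)).
  apply/funext => x; rewrite powR_inv1 ?sqr_ge0// expr2.
  have [->|fx0] := eqVneq (f x) 0; first by rewrite invr0 mul0r.
  by rewrite invfM mulrA divff// mul1r.
apply: measurable_funM => //.
apply: (measurableT_comp (measurable_powR (-1))).
exact: measurable_funX.
Qed.

End measurable_inverse.

Section bounded_measurable.
Context {R : realType} (D : set R).
Implicit Types f g : R -> R[i].

(** The class on which [cint] is linear; closed under the ring operations and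
    under inverses of functions bounded away from zero. *)
Definition bmeas f := [/\ measurable_fun D (fun x => Re (f x)),
  measurable_fun D (fun x => Im (f x)) &
  exists B, forall x, D x -> normc (f x) <= B].

Lemma bmeas_cst c : bmeas (fun=> c).
Proof. by split; [exact: measurable_cst|exact: measurable_cst|exists (normc c)]. Qed.

Lemma bmeasD f g : bmeas f -> bmeas g -> bmeas (fun x => f x + g x).
Proof.
case=> rf jf [B fB] [rg jg [B' gB]]; split.
- by under eq_fun do rewrite raddfD/=; exact: measurable_funD.
- by under eq_fun do rewrite raddfD/=; exact: measurable_funD.
- exists (B + B') => x Dx; apply: le_trans (le_normcD _ _) _.
  by rewrite lerD ?fB ?gB.
Qed.

Lemma bmeasM f g : bmeas f -> bmeas g -> bmeas (fun x => f x * g x).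
Proof.
case=> rf jf [B fB] [rg jg [B' gB]]; split.
- under eq_fun do rewrite Re_mulc.
  by apply: measurable_funB; exact: measurable_funM.
- under eq_fun do rewrite Im_mulc.
  by apply: measurable_funD; exact: measurable_funM.
- exists (B * B') => x Dx; rewrite normcM.
  by rewrite ler_pM ?normc_ge0 ?fB ?gB.
Qed.

Lemma bmeasN f : bmeas f -> bmeas (fun x => - f x).
Proof.
move=> bf; have -> : (fun x : R => - f x) = (fun x => -1 * f x).
  by apply/funext => x; rewrite mulN1r.
exact: (bmeasM (bmeas_cst (-1)) bf).
Qed.

Lemma bmeasB f g : bmeas f -> bmeas g -> bmeas (fun x => f x - g x).
Proof. by move=> bf bg; exact: (bmeasD bf (bmeasN bg)). Qed.

Lemma bmeasX f n : bmeas f -> bmeas (fun x => f x ^+ n).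
Proof.
move=> bf; elim: n => [|n ih]; first exact: bmeas_cst.
by under eq_fun do rewrite exprS; exact: bmeasM.
Qed.

Lemma bmeas_sum (I : Type) (r : seq I) (P : pred I) (F : I -> R -> R[i]) :
  (forall i, bmeas (F i)) -> bmeas (fun x => \sum_(i <- r | P i) F i x).
Proof.
move=> bF; elim: r => [|i r ih].
  by under eq_fun do rewrite big_nil; exact: bmeas_cst.
under eq_fun do rewrite big_cons.
by case: (P i) => //; exact: bmeasD.
Qed.

Lemma bmeasV f (d : R) : 0 < d -> (forall x, D x -> d <= normc (f x)) ->
  bmeas f -> bmeas (fun x => (f x)^-1).
Proof.
move=> d0 fd [rf jf _].
have mV : measurable_fun D (fun x => (normc (f x) ^+ 2)^-1).
  under eq_fun do rewrite normc_sqrE.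
  by apply: measurable_funV; apply: measurable_funD; exact: measurable_funX.
split.
- by under eq_fun do rewrite Re_invc; exact: measurable_funM.
- under eq_fun do rewrite Im_invc.
  by apply: measurable_funN; exact: measurable_funM.
- exists d^-1 => x Dx; rewrite normcV lef_pV2 ?posrE ?fd//.
  exact: lt_le_trans (fd _ Dx).
Qed.

End bounded_measurable.
Arguments bmeas_cst {R D} c.

Lemma bmeas_id (R : realType) (a b : R) : bmeas `[a, b]%classic (fun x => x%:C).
Proof.
split=> /=; [exact: measurable_id|exact: measurable_cst|].
exists (`|a| + `|b|) => x; rewrite /= in_itv/= => /andP[ax xb].
rewrite expr0n/= addr0 sqrtr_sqr ler_norml; apply/andP; split.
  by have := ler_norm (- a); rewrite normrN; have := normr_ge0 b; lra.
by have := ler_norm b; have := normr_ge0 a; lra.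
Qed.

Section complex_integral.
Context {R : realType} (mu : probability R R) (D : set R).
Hypotheses (mD : measurable D) (muD1 : mu D = 1%E).
Implicit Types f g : R -> R[i].

Let fine_muD : fine (mu D) = 1.
Proof. by rewrite muD1. Qed.

Definition cint f : R[i] :=
  (\int[mu]_(x in D) Re (f x)) +i* (\int[mu]_(x in D) Im (f x)).

Lemma bounded_Rintegrable (f : R -> R) (B : R) : measurable_fun D f ->
  (forall x, D x -> `|f x| <= B) -> mu.-integrable D (EFin \o f).
Proof.
move=> mf fB; apply: measurable_bounded_integrable => //.
  exact: (eq_ind_r (fun z => z < +oo)%E (ltry 1) muD1).
exists B; split; first by rewrite num_real.
by move=> x Bx y Dy /=; exact: le_trans (fB _ Dy) (ltW Bx).
Qed.

Lemma bmeas_integrable f : bmeas D f ->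
  mu.-integrable D (EFin \o (fun x => Re (f x))) /\
  mu.-integrable D (EFin \o (fun x => Im (f x))).
Proof.
case=> rf jf [B fB]; split; apply: (@bounded_Rintegrable _ B) => // x Dx.
  exact: le_trans (normc_Re _) (fB _ Dx).
exact: le_trans (normc_Im _) (fB _ Dx).
Qed.

Lemma eq_cint f g : (forall x, D x -> f x = g x) -> cint f = cint g.
Proof.
by move=> fg; congr Complex; apply: eq_Rintegral => x /set_mem Dx; rewrite fg.
Qed.

Lemma cintD f g : bmeas D f -> bmeas D g ->
  cint (fun x => f x + g x) = cint f + cint g.
Proof.
move=> /bmeas_integrable[rf jf] /bmeas_integrable[rg jg].
rewrite /cint; under eq_Rintegral do rewrite raddfD/=.
rewrite RintegralD//; under [X in _ +i* X]eq_Rintegral do rewrite raddfD/=.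
by rewrite RintegralD.
Qed.

Lemma cintM c f : bmeas D f -> cint (fun x => c * f x) = c * cint f.
Proof.
case: c => a b /bmeas_integrable[rf jf].
have rZ k : mu.-integrable D (EFin \o (fun x => k * Re (f x))).
  by have := integrableZl mD k rf.
have jZ k : mu.-integrable D (EFin \o (fun x => k * Im (f x))).
  by have := integrableZl mD k jf.
rewrite /cint; under eq_Rintegral do rewrite Re_mulc/=.
rewrite RintegralB//; under [X in _ +i* X]eq_Rintegral do rewrite Im_mulc/=.
rewrite RintegralD// !RintegralZl//.
Qed.

Lemma cintB f g : bmeas D f -> bmeas D g ->
  cint (fun x => f x - g x) = cint f - cint g.
Proof.
move=> bf bg; rewrite cintD//; last exact: bmeasN.
rewrite (_ : (fun x : R => - g x) = (fun x => -1 * g x)) ?cintM ?mulN1r//.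
by apply/funext => x; rewrite mulN1r.
Qed.

(** The constant is not optimal, but separating the two coordinates keeps the
    bound elementary. *)
Lemma normc_cint f (B : R) : bmeas D f ->
  (forall x, D x -> normc (f x) <= B) -> normc (cint f) <= 2 * B.
Proof.
move=> bf fB; have [rf jf] := bmeas_integrable bf.
have bnd (h : R -> R) : mu.-integrable D (EFin \o h) ->
    (forall x, D x -> `|h x| <= B) -> `|\int[mu]_(x in D) h x| <= B.
  move=> ih hB; apply: le_trans (le_normr_Rintegral _ _) _ => //.
  apply: (@le_trans _ _ (\int[mu]_(x in D) cst B x)); last first.
    by rewrite Rintegral_cst// ?fine_muD// mulr1.
  apply: le_Rintegral => //.
    exact: integrable_norm.
  apply: (@bounded_Rintegrable _ `|B|) => //.
rewrite (le_trans (normc_le_ReIm _))// mulr2n mulrDl mul1r lerD//= bnd// => x Dx.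
  exact: le_trans (normc_Re _) (fB _ Dx).
exact: le_trans (normc_Im _) (fB _ Dx).
Qed.

End complex_integral.

(** * Identity principle through Taylor remainders *)

Section identity_principle.
Context {R : realType}.
Implicit Types (phi : nat -> R[i] -> R[i]) (h : R[i]).

(** [phi n] stands for the [n]-th backward shift of an analytic function: its
    Taylor expansion at the origin with the first [n] terms removed, divided by
    [h ^+ n].  Keeping these functions instead of the coefficients replaces
    convergent series by a one-step recursion. *)
Definition taylor_remainders phi (rho : R) := forall n h, normc h <= rho ->
  phi n h = phi n 0 + h * phi n.+1 h.

(** Zeros accumulating at the origin kill the coefficients [phi n 0] one after
    the other; then [phi 0 h = h ^+ n * phi n h] for all [n], and the geometric
    bound on [phi n] forces this to be zero. *)
Lemma taylor_remainders_vanish phi (rho B Q : R) :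
  taylor_remainders phi rho -> 0 < Q ->
  (forall n h, normc h <= rho -> normc (phi n h) <= B * Q ^+ n) ->
  (forall e, 0 < e -> exists h,
     [/\ h != 0, normc h < e, normc h <= rho & phi 0 h = 0]) ->
  forall h, normc h <= rho -> Q * normc h < 1 -> phi 0 h = 0.
Proof.
move=> sphi Q0 bphi acc.
have [h0 [_ _ h0r _]] := acc 1 ltr01.
have B0 : 0 <= B.
  have := bphi 0 h0 h0r; rewrite expr0 mulr1.
  exact: le_trans (normc_ge0 _).
have at0 n : (forall h, h != 0 -> normc h <= rho -> phi 0 h = 0 -> phi n h = 0) ->
    phi n 0 = 0.
  move=> ph; apply: eq0_normc; apply/eqP; rewrite eq_le normc_ge0 andbT.
  apply/ler_addgt0Pr => e e0; rewrite add0r.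
  have BQ : 0 < B * Q ^+ n.+1 + 1 by rewrite ltr_wpDl// mulr_ge0// exprn_ge0// ltW.
  have [h [h_neq0 he hr ph0]] := acc (e / (B * Q ^+ n.+1 + 1)) (divr_gt0 e0 BQ).
  have := sphi n h hr; rewrite ph// => /esym/eqP; rewrite addr_eq0 => /eqP ->.
  rewrite normcN normcM; apply: (@le_trans _ _ (normc h * (B * Q ^+ n.+1 + 1))).
    by rewrite ler_wpM2l ?normc_ge0// (le_trans (bphi _ _ hr))// lerDl.
  by rewrite -ler_pdivlMr// ltW.
have vanish n : forall h, h != 0 -> normc h <= rho -> phi 0 h = 0 -> phi n h = 0.
  elim: n => // n ih h h_neq0 hr ph0; have := sphi n h hr.
  rewrite ih// (at0 _ ih) add0r => /esym/eqP.
  by rewrite mulf_eq0 (negPf h_neq0)/= => /eqP.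
have phiE h n : normc h <= rho -> phi 0 h = h ^+ n * phi n h.
  move=> hr; elim: n => [|n ->]; first by rewrite expr0 mul1r.
  by rewrite (sphi n h hr) (at0 _ (vanish n)) add0r mulrA exprSr.
move=> h hr Qh; apply: eq0_normc; apply/eqP; rewrite eq_le normc_ge0 andbT.
have Qh0 : 0 <= Q * normc h by rewrite mulr_ge0 ?normc_ge0// ltW.
have cv : (B * (Q * normc h) ^+ n) @[n --> \oo] --> (0 : R).
  rewrite -[X in _ --> X](mulr0 B); apply: cvgMl_tmp.
  by apply: cvg_expr; rewrite ger0_norm.
rewrite -(cvg_lim _ cv)//; apply: limr_ge; first by apply/cvg_ex; eexists; exact: cv.
apply: nearW => n; rewrite (phiE h n hr) normcM normcX.
have -> : B * (Q * normc h) ^+ n = normc h ^+ n * (B * Q ^+ n) by rewrite exprMn; ring.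
by rewrite ler_wpM2l ?exprn_ge0 ?normc_ge0// bphi.
Qed.

End identity_principle.

Section reciprocal.
Context {R : realType} (psi : nat -> R[i] -> R[i]) (c : R[i]).

(** Coefficients of [1 / (c + h * psi 1 h)], where [psi n.+1] is the [n]-th
    backward shift of [psi 1].  Each coefficient depends on all previous ones,
    so the recursion carries the list of those already computed. *)
Fixpoint recip_coefs n : seq R[i] :=
  if n is m.+1 then
    let s := recip_coefs m in
    rcons s (c^-1 * ((m == 0)%N%:R - \sum_(j < m) s`_j * psi (m - j) 0))
  else [::].

Definition recip_coef n := (recip_coefs n.+1)`_n.

(** Removing the first [n] terms of [g = 1 / f] leaves a function whose product
    with [f] is minus the convolution of the coefficients of [g] with the
    remainders of [f]; dividing by [f] gives a formula that makes sense at
    [h = 0]. *)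
Definition recip_remainder n h :=
  (c + h * psi 1 h)^-1 * ((n == 0)%N%:R - \sum_(j < n) recip_coef j * psi (n - j) h).

Lemma size_recip_coefs n : size (recip_coefs n) = n.
Proof. by elim: n => //= n ih; rewrite size_rcons ih. Qed.

Lemma nth_recip_coefs n j : (j < n)%N -> (recip_coefs n)`_j = recip_coef j.
Proof.
elim: n => // n ih; rewrite ltnS leq_eqVlt => /predU1P[->//|jn].
by rewrite /= nth_rcons size_recip_coefs jn ih.
Qed.

Lemma recip_coefE n :
  recip_coef n = c^-1 * ((n == 0)%N%:R - \sum_(j < n) recip_coef j * psi (n - j) 0).
Proof.
rewrite {1}/recip_coef /= nth_rcons size_recip_coefs ltnn eqxx.
by congr (_ * (_ - _)); apply: eq_bigr => j _; rewrite nth_recip_coefs.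
Qed.

Lemma recip_remainder0 n : recip_remainder n 0 = recip_coef n.
Proof. by rewrite /recip_remainder mul0r addr0 -recip_coefE. Qed.

Lemma recip_remainder_step (rho : R) :
  c != 0 -> (forall h, normc h <= rho -> c + h * psi 1 h != 0) ->
  taylor_remainders (fun n => psi n.+1) rho ->
  taylor_remainders recip_remainder rho.
Proof.
move=> c0 f0 spsi n h hr; rewrite recip_remainder0.
apply: (mulfI (f0 h hr)).
rewrite /recip_remainder mulrA divff ?f0// mul1r mulrDr mulrCA mulVKf ?f0//.
rewrite /= sub0r big_ord_recr/= subSnn.
have -> : \sum_(i < n) recip_coef i * psi (n - i) h =
    \sum_(i < n) recip_coef i * psi (n - i) 0 +
    h * \sum_(i < n) recip_coef i * psi (n.+1 - i) h.
  rewrite big_distrr/= -big_split/=; apply: eq_bigr => j _.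
  by rewrite subSn ?(ltnW (ltn_ord j))// -(subnSK (ltn_ord j)) (spsi _ _ hr); ring.
have := recip_coefE n => /(congr1 (fun z => c * z)); rewrite mulrA divff// mul1r.
set S := \sum_(i < n) _ * psi _ 0; set T := \sum_(i < n) _; set b := recip_coef n.
move=> cb; rewrite [(c + _) * b]mulrDl cb; ring.
Qed.

(** The ratio [A * (1 + kappa * M)] is the reciprocal of the radius at which
    the geometric majorant of [f - c] reaches [1 / kappa]. *)
Lemma normc_recip_remainder (rho kappa M A : R) :
  0 <= kappa -> 0 <= M -> 0 <= A -> 0 <= rho ->
  (forall h, normc h <= rho -> normc (c + h * psi 1 h)^-1 <= kappa) ->
  (forall n h, normc h <= rho -> normc (psi n.+1 h) <= M * A ^+ n.+1) ->
  forall n h, normc h <= rho ->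
  normc (recip_remainder n h) <= kappa * (A * (1 + kappa * M)) ^+ n.
Proof.
move=> kappa0 M0 A0 rho0 fk psiM; set Q := A * _.
have Q0 : 0 <= Q by rewrite mulr_ge0// addr_ge0// mulr_ge0.
have geom n : kappa * M * \sum_(j < n) Q ^+ j * A ^+ (n - j) <= Q ^+ n.
  elim: n => [|n ih]; first by rewrite big_ord0 mulr0 expr0.
  rewrite big_ord_recr/= subSnn expr1.
  have -> : \sum_(i < n) Q ^+ i * A ^+ (n.+1 - i) =
            A * \sum_(i < n) Q ^+ i * A ^+ (n - i).
    rewrite big_distrr/=; apply: eq_bigr => j _.
    by rewrite subSn ?(ltnW (ltn_ord j))// exprS mulrCA.
  move: ih; set S := \sum_(i < n) _ => ih.
  have -> : kappa * M * (A * S + Q ^+ n * A) = A * (kappa * M * S + kappa * M * Q ^+ n) by ring.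
  have -> : Q ^+ n.+1 = A * (Q ^+ n + kappa * M * Q ^+ n) by rewrite exprS {1}/Q; ring.
  by rewrite ler_wpM2l// lerD2r.
elim/ltn_ind => n ih h hr; rewrite /recip_remainder normcM.
apply: ler_pM; rewrite ?normc_ge0//; first exact: fk.
case: n ih => [|n] ih.
  by rewrite big_ord0 subr0 normc1 expr0.
rewrite /= sub0r normcN; apply: le_trans (normc_sum _ _ _) _.
apply: le_trans (geom _); rewrite big_distrr/=; apply: ler_sum => j _.
rewrite normcM -recip_remainder0.
have -> : kappa * M * (Q ^+ j * A ^+ (n.+1 - j)) =
  (kappa * Q ^+ j) * (M * A ^+ (n.+1 - j)) by ring.
apply: ler_pM; rewrite ?normc_ge0//; first by rewrite ih// normc0.
by rewrite subSn -1?ltnS// psiM.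
Qed.

End reciprocal.

(** * Stieltjes transforms and analytic continuation of the subordination identity *)

Section stieltjes.
Context {R : realType} (mu : probability R R) (a b : R).
Let D : set R := `[a, b]%classic.
Hypothesis muD1 : mu D = 1%E.
Let mD : measurable D. Proof. exact: measurable_itv. Qed.
Implicit Types (z h : R[i]) (d : R).

Definition stieltjes z : R[i] := cint mu D (fun x => (z - x%:C)^-1).

(** A positive distance to the support interval makes the resolvent bounded and
    its geometric expansion convergent. *)
Definition away d z := forall x, D x -> d <= normc (z - x%:C).

Lemma bmeas_sub z : bmeas D (fun x => z - x%:C).
Proof. exact: (bmeasB (bmeas_cst z) (bmeas_id a b)). Qed.

Lemma bmeas_kernel d z : 0 < d -> away d z -> bmeas D (fun x => (z - x%:C)^-1).
Proof. by move=> d0 dz; exact: (bmeasV d0 dz (bmeas_sub z)). Qed.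

Lemma away_neq0 d z x : 0 < d -> away d z -> D x -> z - x%:C != 0.
Proof. by move=> d0 dz Dx; rewrite -normc_gt0 (lt_le_trans d0)// dz. Qed.

Lemma away_shift d z h : away d z -> normc h <= d / 2 -> away (d / 2) (z + h).
Proof.
move=> dz hd x Dx; rewrite addrAC; apply: le_trans (ler_normc_subl _ _).
by have := dz x Dx; lra.
Qed.

Definition stieltjes_remainder z n h : R[i] :=
  cint mu D (fun x => (-1) ^+ n * ((z - x%:C)^-1) ^+ n * (z + h - x%:C)^-1).

Lemma stieltjes_remainder0 z h : stieltjes_remainder z 0 h = stieltjes (z + h).
Proof. by apply: eq_cint => x _; rewrite !expr0 !mul1r. Qed.

Lemma bmeas_remainder d z n h : 0 < d -> away d z -> normc h <= d / 2 ->
  bmeas D (fun x => (-1) ^+ n * ((z - x%:C)^-1) ^+ n * (z + h - x%:C)^-1).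
Proof.
move=> d0 dz hd; have d20 : 0 < d / 2 by lra.
have bX := bmeasX n (bmeas_kernel d0 dz).
exact: (bmeasM (bmeasM (bmeas_cst ((-1) ^+ n)) bX)
               (bmeas_kernel d20 (away_shift dz hd))).
Qed.

Lemma stieltjes_remainder_step d z : 0 < d -> away d z ->
  taylor_remainders (stieltjes_remainder z) (d / 2).
Proof.
move=> d0 dz n h hd; have d20 : 0 < d / 2 by lra.
rewrite -cintM//; last exact: bmeas_remainder hd.
rewrite -cintD//; last 2 first.
- by apply: (bmeas_remainder _ d0) => //; rewrite normc0 ltW.
- exact: (bmeasM (bmeas_cst h) (bmeas_remainder n.+1 d0 dz hd)).
apply: eq_cint => x Dx.
have u0 := away_neq0 d0 dz Dx.
have v0 := away_neq0 d20 (away_shift dz hd) Dx.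
rewrite addr0 !exprS.
by set e := (-1) ^+ n; set g := _^-1 ^+ n; field; rewrite u0 v0.
Qed.

Lemma normc_stieltjes_remainder d z n h : 0 < d -> away d z ->
  normc h <= d / 2 ->
  normc (stieltjes_remainder z n h) <= 4 / d * d^-1 ^+ n.
Proof.
move=> d0 dz hd; have d20 : 0 < d / 2 by lra.
have -> : 4 / d * d^-1 ^+ n = 2 * (d^-1 ^+ n * (d / 2)^-1).
  by rewrite invfM invrK; ring.
apply: normc_cint => //; first exact: bmeas_remainder hd.
move=> x Dx; rewrite !normcM !normcX !normcV normcN normc1 expr1n mul1r.
have u0 := dz x Dx; have v0 := away_shift dz hd Dx.
apply: ler_pM; rewrite ?exprn_ge0 ?invr_ge0 ?normc_ge0//.
  rewrite lerXn2r ?nnegrE ?invr_ge0 ?normc_ge0 ?(ltW d0)//.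
  by rewrite lef_pV2 ?posrE// (lt_le_trans d0).
by rewrite lef_pV2 ?posrE// (lt_le_trans d20).
Qed.

End stieltjes.

Section subordination.
Context {R : realType} (muT muD : probability R R) (aT bT aD bD t : R).
Hypotheses (muT1 : muT `[aT, bT]%classic = 1%E)
           (muD1 : muD `[aD, bD]%classic = 1%E).
Implicit Types (z h : R[i]) (d : R).

Local Notation GT := (stieltjes muT aT bT).
Local Notation GD := (stieltjes muD aD bD).

(** The subordination function: where [muT] is the free convolution of [muD]
    with the semicircle law of variance [t], the transform of [muT] at [z] is
    that of [muD] at [omega z]. *)
Definition omega z := z - t%:C * GT z.
Definition subordination_gap z := GT z - GD (omega z).
Definition regular_point z :=
  exists2 d, 0 < d & away aT bT d z /\ away aD bD d (omega z).

Definition omega_remainder z n h :=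
  (n == 1)%N%:R - t%:C * stieltjes_remainder muT aT bT z n h.

Lemma omega_shift d z h : 0 < d -> away aT bT d z -> normc h <= d / 2 ->
  omega (z + h) = omega z + h * omega_remainder z 1 h.
Proof.
move=> d0 dz hd; rewrite /omega /omega_remainder/=.
rewrite -!stieltjes_remainder0 (stieltjes_remainder_step muT1 d0 dz 0 hd).
have -> : GT z = stieltjes_remainder muT aT bT z 0 0.
  by rewrite stieltjes_remainder0 addr0.
ring.
Qed.

Lemma omega_remainder_step d z : 0 < d -> away aT bT d z ->
  taylor_remainders (fun n => omega_remainder z n.+1) (d / 2).
Proof.
move=> d0 dz n h hd; rewrite /omega_remainder.
by rewrite (stieltjes_remainder_step muT1 d0 dz n.+1 hd) /=; ring.
Qed.

Lemma normc_omega_remainder d z n h : 0 < d -> away aT bT d z ->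
  normc h <= d / 2 ->
  normc (omega_remainder z n.+1 h) <= (d + `|t| * 4 / d) * d^-1 ^+ n.+1.
Proof.
move=> d0 dz hd; apply: le_trans (le_normcB _ _) _; rewrite mulrDl lerD//.
  rewrite eqSS; have [->|_] := eqVneq n 0%N.
    by rewrite expr1 divff ?gt_eqF// mulr1n normc1.
  by rewrite normc0 mulr_ge0 ?exprn_ge0 ?invr_ge0// ltW.
rewrite normcM normc_real -!mulrA ler_wpM2l// mulrA.
exact: normc_stieltjes_remainder.
Qed.

Lemma bmeas_recip_remainder d w psi n h : 0 < d -> away aD bD d w ->
  away aD bD (d / 2) (w + h * psi 1%N h) ->
  bmeas `[aD, bD]%classic (fun x => recip_remainder psi (w - x%:C) n h).
Proof.
move=> d0 dw dwh; have d20 : 0 < d / 2 by lra.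
have bV : bmeas `[aD, bD]%classic (fun x => (w - x%:C + h * psi 1%N h)^-1).
  rewrite (_ : (fun x => _) = (fun x : R => (w + h * psi 1%N h - x%:C)^-1)).
    exact: bmeas_kernel d20 dwh.
  by apply/funext => x; rewrite addrAC.
have bS m k : (forall j, (j < m)%N -> 
      bmeas `[aD, bD]%classic (fun x => recip_coef psi (w - x%:C) j)) ->
    bmeas `[aD, bD]%classic (fun x => (m == 0)%N%:R -
      \sum_(j < m) recip_coef psi (w - x%:C) j * psi (m - j)%N k).
  move=> ih; apply: (bmeasB (bmeas_cst _)); apply: bmeas_sum => j.
  exact: (bmeasM (ih _ (ltn_ord j)) (bmeas_cst _)).
have bC m : bmeas `[aD, bD]%classic (fun x => recip_coef psi (w - x%:C) m).
  elim/ltn_ind: m => m ih; rewrite (funext (fun x => recip_coefE _ _ m)).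
  exact: (bmeasM (bmeas_kernel d0 dw) (bS m 0 ih)).
exact: (bmeasM bV (bS n h (fun j _ => bC j))).
Qed.

(** Near a regular point the gap is analytic: the shifts of the resolvent of
    [muD] at [omega (z + h)] are those of the reciprocal of [omega (z + h) - x],
    with bounds uniform in [x], hence they can be integrated against [muD]. *)
Lemma gap_local z : regular_point z ->
  (forall e, 0 < e -> exists h, [/\ h != 0, normc h < e & subordination_gap (z + h) = 0]) ->
  exists2 rho, 0 < rho & forall h, normc h < rho -> subordination_gap (z + h) = 0.
Proof.
case=> d d0 [dz dw] acc.
pose psi := omega_remainder z; pose w := omega z.
pose M := d + `|t| * 4 / d.
have M0 : 0 < M by rewrite ltr_wpDr// mulr_ge0 ?invr_ge0 ?mulr_ge0// ltW.
pose rho := Num.min (d / 2) (d / 2 * (d / M)).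
have d20 : 0 < d / 2 by lra.
have rho0 : 0 < rho by rewrite lt_min d20/= mulr_gt0// divr_gt0.
have rhod : rho <= d / 2 by rewrite ge_min lexx.
have hpsi h : normc h <= rho -> normc (h * psi 1%N h) <= d / 2.
  move=> hr; have hd := le_trans hr rhod; rewrite normcM.
  have := normc_omega_remainder 0 d0 dz hd; rewrite expr1 -/M => pM.
  have : normc h <= d / 2 * (d / M) by apply: le_trans hr _; rewrite ge_min lexx orbT.
  move=> hM; apply: (@le_trans _ _ ((d / 2 * (d / M)) * (M / d))).
    by rewrite ler_pM ?normc_ge0.
  have -> // : d / 2 * (d / M) * (M / d) = d / 2.
  by field; rewrite !gt_eqF.
have dwh h : normc h <= rho -> away aD bD (d / 2) (w + h * psi 1%N h).
  by move=> hr; apply: away_shift => //; exact: hpsi.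
pose kappa := 2 / d.
have kappa0 : 0 < kappa by rewrite divr_gt0.
pose rr n h := cint muD `[aD, bD]%classic
  (fun x => recip_remainder psi (w - x%:C) n h).
pose phi n h := stieltjes_remainder muT aT bT z n h - rr n h.
pose Q := d^-1 * (1 + kappa * M).
have di0 : 0 < d^-1 by rewrite invr_gt0.
have kM0 : 0 < kappa * M by rewrite mulr_gt0.
have dQ : d^-1 <= Q by rewrite ler_peMr ?(ltW di0)// lerDl ltW.
have Q0 : 0 < Q by exact: lt_le_trans dQ.
have phiE h : normc h <= rho -> phi 0%N h = subordination_gap (z + h).
  move=> hr; rewrite /phi /subordination_gap stieltjes_remainder0.
  rewrite (omega_shift d0 dz (le_trans hr rhod)); congr (_ - _).
  apply: eq_cint => x _; rewrite /recip_remainder big_ord0 subr0 mulr1 -/psi.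
  by rewrite addrAC.
have step : taylor_remainders phi rho.
  move=> n h hr; have hd := le_trans hr rhod; rewrite /phi.
  rewrite (stieltjes_remainder_step muT1 d0 dz n hd).
  have -> : rr n h = rr n 0 + h * rr n.+1 h.
    rewrite /rr -cintM//; last by apply: (bmeas_recip_remainder n.+1 d0 dw); exact: dwh.
    rewrite -cintD//; last 2 first.
    - by apply: (bmeas_recip_remainder n d0 dw); apply: dwh; rewrite normc0 ltW.
    - apply: (bmeasM (bmeas_cst h)).
      by apply: (bmeas_recip_remainder n.+1 d0 dw); exact: dwh.
    apply: eq_cint => x Dx; apply: (@recip_remainder_step _ _ _ rho) => //.
    - exact: away_neq0 d0 dw Dx.
    - move=> k kr; rewrite addrAC; exact: away_neq0 d20 (dwh _ kr) Dx.
    - by move=> m k kr; apply: (omega_remainder_step d0 dz); exact: le_trans kr rhod.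
  ring.
have bnd n h : normc h <= rho -> normc (phi n h) <= (4 / d + 2 * kappa) * Q ^+ n.
  move=> hr; have hd := le_trans hr rhod.
  apply: le_trans (le_normcB _ _) _; rewrite mulrDl lerD//.
    apply: le_trans (normc_stieltjes_remainder muT1 n d0 dz hd) _.
    by rewrite ler_wpM2l ?divr_ge0 ?(ltW d0)// lerXn2r// nnegrE ltW.
  rewrite -mulrA; apply: normc_cint => //.
    by apply: (bmeas_recip_remainder n d0 dw); exact: dwh.
  move=> x Dx; apply: (@normc_recip_remainder _ _ _ rho) => //; try exact: ltW.
  - move=> k kr; rewrite normcV addrAC /kappa -[2 / d]invrK lef_pV2 ?posrE.
    + by rewrite invf_div; exact: dwh.
    + by apply: lt_le_trans d20 _; exact: dwh.
    + by rewrite invf_div.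
  - move=> m k kr; apply: normc_omega_remainder => //; exact: le_trans kr rhod.
exists (Num.min rho Q^-1); first by rewrite lt_min rho0 invr_gt0.
move=> h; rewrite lt_min => /andP[hr hQ].
rewrite -phiE ?ltW//.
apply: (taylor_remainders_vanish step Q0 bnd) => //; last 2 first.
- exact: ltW.
- by rewrite mulrC -ltr_pdivlMr// div1r.
move=> e e0; have [|k [k0 ke Fk]] := acc (Num.min e rho).
  by rewrite lt_min e0.
move: ke; rewrite lt_min => /andP[ke kr].
by exists k; split => //; rewrite ?phiE ?ltW.
Qed.

(** Analytic continuation along a segment: the set of parameters up to which the
    gap vanishes is closed under suprema and, by [gap_local], open. *)
Lemma gap_segment p q :
  (forall s : R, 0 <= s <= 1 -> regular_point (p + s%:C * (q - p))) ->
  (forall e, 0 < e -> exists h, [/\ h != 0, normc h < e & subordination_gap (p + h) = 0]) ->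
  subordination_gap q = 0.
Proof.
move=> reg acc.
have [->|pq] := eqVneq q p.
  have [|rho rho0 H] := gap_local _ acc.
    by have := reg 0; rewrite rmorph0 mul0r addr0; apply; rewrite lexx ler01.
  by rewrite -(addr0 p) H// normc0.
have nqp : 0 < normc (q - p) by rewrite normc_gt0 subr_eq0.
pose P s := forall r : R, 0 <= r <= s -> subordination_gap (p + r%:C * (q - p)) = 0.
pose S := [set s : R | 0 <= s <= 1 /\ P s].
have nrm s r : normc ((s - r)%:C * (q - p)) = `|s - r| * normc (q - p).
  by rewrite normcM normc_real.
have S0 : exists2 s, 0 < s & S s.
  have [|rho rho0 H] := gap_local _ acc.
    by have := reg 0; rewrite rmorph0 mul0r addr0; apply; rewrite lexx ler01.
  pose s := Num.min 1 (rho / 2 / normc (q - p)).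
  have s0 : 0 < s by rewrite lt_min ltr01 !divr_gt0.
  exists s => //; split; first by rewrite ltW//= ge_min lexx.
  move=> r /andP[r0 rs]; apply: H; rewrite normcM normc_real ger0_norm//.
  have : r <= rho / 2 / normc (q - p) by apply: le_trans rs _; rewrite ge_min lexx orbT.
  by rewrite ler_pdivlMr// => /le_lt_trans; apply; lra.
have ubS : has_ubound S by exists 1 => s [/andP[]].
have [s1 s10 Ss1] := S0.
have supS : has_sup S by split => //; exists s1.
pose s := sup S.
have s1s : s1 <= s by exact: ub_le_sup.
have s0 : 0 < s by exact: lt_le_trans s10 _.
have s_le1 : s <= 1 by apply: ge_sup => //; [exists s1|move=> r [/andP[]]].
have Plt r : 0 <= r < s -> subordination_gap (p + r%:C * (q - p)) = 0.
  move=> /andP[r0 rs]; have [r' [_ Pr'] rr'] := sup_gt supS.1 rs.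
  by apply: Pr'; rewrite r0 ltW.
have regs := reg s; rewrite (ltW s0) s_le1 in regs.
have [|rho rho0 H] := gap_local (regs isT).
  move=> e e0; pose r := Num.max 0 (s - e / 2 / normc (q - p)).
  have ee : 0 < e / 2 / normc (q - p) by rewrite !divr_gt0.
  have rs : r < s by rewrite gt_max s0/=; lra.
  have r0 : 0 <= r by rewrite le_max lexx.
  exists ((r - s)%:C * (q - p)); split.
  - by rewrite -normc_gt0 nrm mulr_gt0// normr_gt0 subr_eq0 lt_eqF.
  - rewrite nrm distrC gtr0_norm ?subr_gt0//.
    have : s - r <= e / 2 / normc (q - p).
      have : s - e / 2 / normc (q - p) <= r by rewrite le_max lexx orbT.
      lra.
    by rewrite ler_pdivlMr// => /le_lt_trans; apply; lra.
  - have -> : p + s%:C * (q - p) + (r - s)%:C * (q - p) = p + r%:C * (q - p).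
      by rewrite rmorphB/=; ring.
    by apply: Plt; rewrite r0.
have Hs r : `|r - s| * normc (q - p) < rho -> subordination_gap (p + r%:C * (q - p)) = 0.
  move=> rsr; have -> : p + r%:C * (q - p) = p + s%:C * (q - p) + (r - s)%:C * (q - p).
    by rewrite rmorphB/=; ring.
  by apply: H; rewrite nrm.
have [s_eq1|s_neq1] := eqVneq s 1.
  have := Hs 1; rewrite s_eq1 subrr normr0 mul0r rmorph1 mul1r addrC subrK.
  exact.
have s_lt1 : s < 1 by rewrite lt_neqAle s_neq1.
pose e := rho / 2 / normc (q - p).
have e0 : 0 < e by rewrite !divr_gt0.
pose s2 := Num.min 1 (s + e).
have ss2 : s < s2 by rewrite lt_min s_lt1/=; lra.
have : S s2.
  split; first by rewrite (le_trans (ltW s0) (ltW ss2))/= ge_min lexx.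
  move=> r /andP[r0 rs2]; have [rs|sr] := ltP r s; first by apply: Plt; rewrite r0.
  apply: Hs; rewrite ger0_norm ?subr_ge0//.
  have : r - s <= e.
    have : s2 <= s + e by rewrite ge_min lexx orbT.
    by lra.
  by rewrite /e ler_pdivlMr// => /le_lt_trans; apply; lra.
by move=> /(ub_le_sup ubS); rewrite leNgt ss2.
Qed.

End subordination.

(** * Support and real Cauchy transform *)

Section support.
Context {R : realType} (mu : probability R R).

Lemma msupport_sub_itv a b : mu `[a, b]%classic = 1%E -> msupport mu `<=` `[a, b].
Proof.
move=> mu1 x Sx; apply: contrapT => xab.
have mI : measurable (`[a, b]%classic : set R) by exact: measurable_itv.
have oC : open (~` `[a, b]%classic : set R).
  by rewrite openC; exact: interval_closed.
have := Sx _ oC xab.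
by rewrite probability_setC// mu1 subee// ltxx.
Qed.

(** The complement of the support is covered by the countably many null
    intervals with rational endpoints. *)
Lemma negligible_setC_msupport : mu.-negligible (~` msupport mu).
Proof.
pose I (pq : rat * rat) : set R := `]ratr pq.1, ratr pq.2[%classic.
pose F k := if unpickle k is Some pq then
  if mu (I pq) == 0%E then I pq else set0 else set0.
apply: (@negligibleS _ _ _ _ (\bigcup_k F k)); last first.
  apply: negligible_bigcup => k; rewrite /F.
  case: unpickle => [pq|]; last exact: negligible_set0.
  case: eqP => [Ipq|_]; last exact: negligible_set0.
  by apply/negligibleP => //; exact: measurable_itv.
move=> x /= /existsNP[U /not_implyP[oU /not_implyP[Ux /negP]]].
rewrite -leNgt measure_le0 => /eqP U0.
have [e /= e0 eU] : nbhs_ball x U by apply/nbhs_ballP; exact: open_nbhs_nbhs.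
have [p] : exists q : rat, ratr q \in `]x - e, x[ by apply: rat_in_itvoo; lra.
rewrite in_itv/= => /andP[xp px].
have [q] : exists q : rat, ratr q \in `]x, x + e[ by apply: rat_in_itvoo; lra.
rewrite in_itv/= => /andP[xq qx].
have IU : I (p, q) `<=` U.
  move=> y; rewrite /I/= in_itv/= => /andP[py yq]; apply: eU.
  by rewrite /ball/= ltr_norml; apply/andP; split; lra.
have I0 : mu (I (p, q)) = 0%E.
  apply/eqP; rewrite -measure_le0 -U0 le_measure// inE; first exact: measurable_itv.
  exact: open_measurable.
have [k kE] : exists k, unpickle k = Some (p, q).
  by exists (pickle (p, q)); rewrite pickleK.
exists k => //; rewrite /F kE.
by rewrite I0 eqxx /I/= in_itv/= px xq.
Qed.

Lemma msupport_neq0 : msupport mu !=set0.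
Proof.
apply/set0P/negP => /eqP S0; have := negligible_setC_msupport.
rewrite S0 setC0 => /negligibleP => /(_ measurableT).
move=> m0; have := probability_setT mu; rewrite m0 => /esym/eqP.
by rewrite onee_eq0.
Qed.

Hypothesis bddS : bounded_set (msupport mu).

Let bS : exists M : R, forall x, msupport mu x -> `|x| <= M.
Proof.
have [M [_ MS]] := bddS.
by exists (M + 1) => x Sx; apply: MS => //; rewrite ltrDl.
Qed.

Let hl : has_lbound (msupport mu).
Proof.
have [M MS] := bS; exists (- M) => x /MS; rewrite ler_norml => /andP[].
by [].
Qed.

Let hu : has_ubound (msupport mu).
Proof.
have [M MS] := bS; exists M => x /MS; rewrite ler_norml => /andP[].
by [].
Qed.

Lemma msupport_itv : msupport mu `<=` `[left_edge mu, right_edge mu].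
Proof.
move=> x Sx; rewrite /= in_itv/=; apply/andP; split.
  exact: ge_inf.
exact: ub_le_sup.
Qed.

Lemma left_le_right : left_edge mu <= right_edge mu.
Proof.
have [x /msupport_itv] := msupport_neq0; rewrite /= in_itv/= => /andP[].
exact: le_trans.
Qed.

Lemma support_itv_full : mu `[left_edge mu, right_edge mu]%classic = 1%E.
Proof.
have mI : measurable (`[left_edge mu, right_edge mu]%classic : set R).
  exact: measurable_itv.
have : mu (~` `[left_edge mu, right_edge mu]%classic) = 0%E.
  apply/negligibleP; first exact: measurableC.
  by apply: negligibleS negligible_setC_msupport; exact/subsetC/msupport_itv.
have := probability_setC mu (measurableC mI); rewrite setCK => -> ->.
by rewrite sube0.
Qed.

Lemma left_edge_mass e : 0 < e ->
  (0 < mu `[(left_edge mu - 1)%R, (left_edge mu + e)%R]%classic)%E.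
Proof.
move=> e0; have [x Sx xe] : exists2 x, msupport mu x & x < left_edge mu + e.
  by apply: inf_lt; [exact: msupport_neq0|rewrite ltrDl].
have := msupport_itv Sx; rewrite /= in_itv/= => /andP[lx _].
pose U : set R := `]left_edge mu - 1, left_edge mu + e[%classic.
apply: (@lt_le_trans _ _ (mu U)).
  apply: Sx; first exact: interval_open.
  by rewrite /U/= in_itv/= xe andbT; lra.
apply: le_measure; rewrite ?inE; try exact: measurable_itv.
by apply: subset_itv; rewrite bnd_simp.
Qed.

End support.

Section real_transform.
Context {R : realType} (mu : probability R R) (a b : R).
Let D : set R := `[a, b]%classic.
Hypothesis muD1 : mu D = 1%E.
Let mD : measurable D. Proof. exact: measurable_itv. Qed.

Lemma le_ab : a <= b.
Proof.
rewrite leNgt; apply/negP => ba; move: muD1.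
by rewrite /D set_itv_ge -?leNgt ?bnd_simp// measure0 => /esym/eqP; rewrite onee_eq0.
Qed.

Lemma measurable_kernel (A : set R) z :
  measurable_fun A (fun x : R => (z - x)^-1).
Proof. by apply: measurable_funV; apply: measurable_funB. Qed.

Lemma cauchy_transform_itv z :
  cauchy_transform mu z = \int[mu]_(x in D) (z - x)^-1.
Proof.
rewrite /cauchy_transform /Rintegral; congr fine.
rewrite [RHS]integral_mkcond; apply: ae_eq_integral => //.
- by apply/measurable_EFinP; exact: measurable_kernel.
- by apply/(measurable_restrictT _ mD)/measurable_EFinP; exact: measurable_kernel.
have m0 : mu (~` D) = 0%E by rewrite probability_setC// muD1 subee.
exists (~` D); split; [exact: measurableC|exact: m0|].
by move=> x /= /not_implyP[_]; apply: contra_not => Dx; rewrite patchE mem_set.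
Qed.

Lemma stieltjes_real z : stieltjes mu a b z%:C = (cauchy_transform mu z)%:C.
Proof.
have kE x : (z%:C - x%:C)^-1 = ((z - x)^-1)%:C by rewrite -rmorphB -fmorphV.
rewrite cauchy_transform_itv; congr Complex.
  by apply: eq_Rintegral => x _; rewrite kE.
by rewrite (@eq_Rintegral _ _ _ mu D (cst 0)) ?Rintegral_cst ?mul0r// => x _; rewrite kE.
Qed.

Lemma Rintegral_bounds (f : R -> R) m M : measurable_fun D f ->
  (forall x, D x -> m <= f x <= M) -> m <= \int[mu]_(x in D) f x <= M.
Proof.
move=> mf fb; have If : mu.-integrable D (EFin \o f).
  apply: (@bounded_Rintegrable _ _ _ mD muD1 _ (`|m| + `|M|)) => // x /fb /andP[mfx fxM].
  rewrite ler_norml; apply/andP; split.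
    by have := ler_norm (- m); rewrite normrN; have := normr_ge0 M; lra.
  by have := ler_norm M; have := normr_ge0 m; lra.
have Ic c : mu.-integrable D (EFin \o cst c).
  by apply: (@bounded_Rintegrable _ _ _ mD muD1 _ `|c|).
have cE c : \int[mu]_(x in D) cst c x = c.
  rewrite Rintegral_cst//; have -> : fine (mu D) = 1 by rewrite muD1.
  by rewrite mulr1.
apply/andP; split; [rewrite -{1}(cE m)|rewrite -(cE M)];
  by apply: le_Rintegral => // x /fb /andP[].
Qed.

Lemma kernel_integrable z : z < a \/ b < z ->
  mu.-integrable D (EFin \o (fun x => (z - x)^-1)).
Proof.
case=> zab.
  apply: (@bounded_Rintegrable _ _ _ mD muD1 _ (a - z)^-1); first exact: measurable_kernel.
  move=> x; rewrite /D/= in_itv/= => /andP[ax xb].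
  rewrite normfV ltr0_norm; last lra.
  by rewrite lef_pV2 ?posrE; lra.
apply: (@bounded_Rintegrable _ _ _ mD muD1 _ (z - b)^-1); first exact: measurable_kernel.
move=> x; rewrite /D/= in_itv/= => /andP[ax xb].
rewrite normfV gtr0_norm; last lra.
by rewrite lef_pV2 ?posrE; lra.
Qed.

Lemma cauchy_transform_left z : z < a ->
  - (a - z)^-1 <= cauchy_transform mu z <= - (b - z)^-1.
Proof.
move=> za; have ab := le_ab; rewrite cauchy_transform_itv.
apply: Rintegral_bounds => [|x]; first exact: measurable_kernel.
rewrite /D/= in_itv/= => /andP[ax xb].
have -> : (z - x)^-1 = - (x - z)^-1 by rewrite -invrN opprB.
by rewrite !lerN2 !lef_pV2 ?posrE; try lra; apply/andP; split; lra.
Qed.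

Lemma cauchy_transform_left_lt0 z : z < a -> cauchy_transform mu z < 0.
Proof.
move=> za; have ab := le_ab; have /andP[_] := cauchy_transform_left za.
move=> /le_lt_trans; apply; rewrite oppr_lt0 invr_gt0; lra.
Qed.

Lemma cauchy_transform_right_gt0 z : b < z -> 0 < cauchy_transform mu z.
Proof.
move=> bz; have ab := le_ab; rewrite cauchy_transform_itv.
have /andP[+ _] : (z - a)^-1 <= \int[mu]_(x in D) (z - x)^-1 <= (z - b)^-1.
  apply: Rintegral_bounds => [|x]; first exact: measurable_kernel.
  rewrite /D/= in_itv/= => /andP[ax xb].
  by rewrite !lef_pV2 ?posrE; try lra; apply/andP; split; lra.
by apply: lt_le_trans; rewrite invr_gt0; lra.
Qed.

Lemma cauchy_transform_diff z z' : z < z' -> z' < a ->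
  (z' - z) / (b - z) ^+ 2 <= cauchy_transform mu z - cauchy_transform mu z'
  <= (z' - z) / (a - z') ^+ 2.
Proof.
move=> zz' z'a; have ab := le_ab; have za := lt_trans zz' z'a.
rewrite !cauchy_transform_itv -RintegralB//; last 2 first.
- by apply: kernel_integrable; left.
- by apply: kernel_integrable; left.
apply: Rintegral_bounds => [|x].
  by apply: measurable_funB; exact: measurable_kernel.
rewrite /D/= in_itv/= => /andP[ax xb].
have -> : (z - x)^-1 - (z' - x)^-1 = (z' - z) / ((x - z) * (x - z')).
  by field; apply/and4P; split; rewrite subr_eq0; apply/eqP; lra.
apply/andP; split; rewrite ler_wpM2l ?subr_ge0 ?(ltW zz')// lef_pV2 ?posrE ?exprn_gt0 ?mulr_gt0 ?subr_gt0 ?expr2//; try lra.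
- by apply: ler_pM; lra.
- by apply: ler_pM; lra.
Qed.

Lemma cauchy_transform_inj z z' : z < a -> z' < a ->
  cauchy_transform mu z = cauchy_transform mu z' -> z = z'.
Proof.
have ab := le_ab.
have lt y y' : y < y' -> y' < a -> cauchy_transform mu y <> cauchy_transform mu y'.
  move=> yy' y'a gE; have /andP[+ _] := cauchy_transform_diff yy' y'a.
  rewrite gE subrr leNgt => /negP; apply; rewrite divr_gt0 ?subr_gt0//.
  by rewrite exprn_gt0 ?subr_gt0//; lra.
move=> za z'a gE; have [zz'|z'z|//] := ltgtP z z'.
  by have := lt _ _ zz' z'a gE.
by have := lt _ _ z'z za (esym gE).
Qed.

Lemma cauchy_transform_continuous z : z < a ->
  {for z, continuous (cauchy_transform mu)}.
Proof.
move=> za; apply/cvgrPdist_le => e e0.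
pose d := (a - z) / 2; have d0 : 0 < d by rewrite /d; lra.
pose r := Num.min d (e * d ^+ 2).
have r0 : 0 < r by rewrite lt_min d0 mulr_gt0// exprn_gt0.
have key x y : x < y -> y <= z + d -> y - x <= e * d ^+ 2 ->
    `|cauchy_transform mu x - cauchy_transform mu y| <= e.
  move=> xy yd yx; have ya : y < a by rewrite /d in yd; lra.
  have /andP[lo hi] := cauchy_transform_diff xy ya.
  rewrite ger0_norm; last first.
    by apply: le_trans lo; rewrite divr_ge0 ?sqr_ge0// subr_ge0 ltW.
  apply: le_trans hi _; rewrite ler_pdivrMr ?exprn_gt0 ?subr_gt0//.
  apply: le_trans yx _; rewrite ler_wpM2l ?(ltW e0)//.
  by rewrite /d in yd *; rewrite lerXn2r ?nnegrE; lra.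
near=> x; have : `|z - x| <= r by near: x; exact: cvgr_dist_le.
rewrite le_min => /andP[xd xe].
have [zx|xz|<-] := ltgtP z x; last by rewrite subrr normr0 ltW.
- apply: key => //; first by move: xd; rewrite ltr0_norm => [xd|]; lra.
  by move: xe; rewrite ltr0_norm => [xe|]; lra.
- rewrite distrC; apply: key => //; first by lra.
  by move: xe; rewrite gtr0_norm => [xe|]; lra.
Unshelve. all: by end_near. Qed.

Lemma cauchy_transform_surj w : w < 0 -> - (b - a + 1)^-1 <= w ->
  exists2 z, z < a & cauchy_transform mu z = w.
Proof.
move=> w0 wab; have ab := le_ab.
pose z1 := Num.min (a - 1) (a + w^-1).
have z1a : z1 <= a - 1 by rewrite ge_min lexx.
have z1w : z1 <= a + w^-1 by rewrite ge_min lexx orbT.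
have g1 : w <= cauchy_transform mu z1.
  have /andP[+ _] : - (a - z1)^-1 <= cauchy_transform mu z1 <= - (b - z1)^-1.
    by apply: cauchy_transform_left; lra.
  move=> lo; apply: le_trans lo; rewrite lerNr -[leRHS]invrK.
  by rewrite lef_pV2 ?posrE ?invr_gt0 ?invrN; lra.
have g2 : cauchy_transform mu (a - 1) <= w.
  have /andP[_] : - (a - (a - 1))^-1 <= cauchy_transform mu (a - 1) <= - (b - (a - 1))^-1.
    by apply: cauchy_transform_left; lra.
  by move=> hi; apply: le_trans hi _; rewrite (_ : b - (a - 1) = b - a + 1); [|ring].
have [||z zI gz] := @IVT _ (cauchy_transform mu) z1 (a - 1) w z1a.
- apply: continuous_in_subspaceT => x; rewrite inE/= in_itv/= => /andP[_ xa].
  by apply: cauchy_transform_continuous; lra.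
- by rewrite ge_min g2 orbT le_max g1.
exists z => //; move: zI; rewrite in_itv/= => /andP[_ za]; lra.
Qed.

End real_transform.

Section inverse.
Context {R : realType} (mu : probability R R).
Hypothesis bddS : bounded_set (msupport mu).
Let mu1 := support_itv_full bddS.

Lemma cauchy_inverse_left z : z < left_edge mu ->
  cauchy_inverse mu (cauchy_transform mu z) = z.
Proof.
move=> zl; rewrite /cauchy_inverse; apply: xget_unique.
  by split => //; left.
move=> y [[yl|yr] gE]; first exact: (cauchy_transform_inj mu1).
have := cauchy_transform_right_gt0 mu1 yr.
have := cauchy_transform_left_lt0 mu1 zl.
by rewrite gE => /lt_trans/[apply]; rewrite ltxx.
Qed.

(** A small negative [w] is reached exactly once outside the support, on the
    left, so the choice made in the definition of the inverse is forced. *)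
Lemma cauchy_inverseK : \forall w \near (0 : R)^'-,
  cauchy_inverse mu w < left_edge mu /\
  cauchy_transform mu (cauchy_inverse mu w) = w.
Proof.
have lr := left_le_right bddS.
near=> w.
have w0 : w < 0 by near: w; exact: nbhs_left_lt.
have wl : - (right_edge mu - left_edge mu + 1)^-1 <= w.
  near: w; apply: nbhs_left_ge; rewrite oppr_lt0 invr_gt0; lra.
have [z zl <-] := cauchy_transform_surj mu1 w0 wl.
by rewrite cauchy_inverse_left.
Unshelve. all: by end_near. Qed.

End inverse.

(** * The R-transform of the semicircle law *)

Section density.
Context {R : realType} (nu : probability R R) (f : R -> R).
Hypothesis fnu : has_density nu f.
Local Notation leb := (@lebesgue_measure R).

(** Lebesgue measure lives on a copy of the line that carries its own measurable
    structure; the identity transports [nu] there. *)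
Let toM (x : R) : measurableTypeR R := x.

Let measurable_toM : measurable_fun [set: R] toM.
Proof. by move=> _ A mA; rewrite setTI. Qed.

HB.instance Definition _ := isMeasurableFun.Build _ _ R (measurableTypeR R) toM
  measurable_toM.

Let nuM : probability (measurableTypeR R) R := distribution nu toM.

Let mf : measurable_fun [set: measurableTypeR R] (EFin \o f).
Proof. by apply/measurable_EFinP; case: fnu. Qed.

Let nuME A : measurable A -> nuM A = (\int[leb]_(x in A) (f x)%:E)%E.
Proof. by move=> mA; case: fnu => _ [_ <-]. Qed.

Let density_dominates : nuM `<< leb.
Proof.
apply/null_content_dominatesP => A mA A0; rewrite nuME//.
by apply: null_set_integral => //; exact: measurable_funTS.
Qed.

Lemma ge0_integral_density (g : R -> \bar R) (E : set R) : (forall x, 0 <= g x)%E ->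
  measurable E -> measurable_fun E g ->
  (\int[nu]_(x in E) g x = \int[leb]_(x in E) (g x * (f x)%:E))%E.
Proof.
move=> g0 mE mg; have dom := density_dominates.
transitivity (\int[nuM]_(x in E) g x)%E.
  by rewrite /nuM/= /distribution ge0_integral_pushforward.
rewrite -(@Radon_Nikodym_SigmaFinite.change_of_variables _ _ R nuM leb dom g E)//.
have iRN := @Radon_Nikodym_SigmaFinite.f_integrable _ _ R nuM leb dom.
have mRN := measurable_int _ iRN.
apply: ae_eq_integral => //.
- by apply: emeasurable_funM => //; exact: measurable_funTS mRN.
- by apply: emeasurable_funM => //; exact: measurable_funTS mf.
have ae : ae_eq leb [set: measurableTypeR R]
    (Radon_Nikodym_SigmaFinite.f nuM leb) (EFin \o f).
  apply: integral_ae_eq => // A _ mA.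
  by rewrite -(@Radon_Nikodym_SigmaFinite.f_integral _ _ R nuM leb dom)//; exact: nuME.
by apply: ae_eqe_mul2l; exact: ae_eq_subset ae.
Qed.

End density.

Section semicircle_transform.
Context {R : realType} (t : R).
Hypothesis t0 : 0 < t.
Local Notation leb := (@lebesgue_measure R).
Let s : R := Num.sqrt t.
Let s0 : 0 < s. Proof. by rewrite sqrtr_gt0. Qed.
Let s2 : s ^+ 2 = t. Proof. exact: sqr_sqrtr (ltW t0). Qed.

Lemma semicircle_has_density : has_density (semicircle_law t0) (semicircle_pdf t).
Proof.
split; [exact: measurable_semicircle_pdf|split => // x].
exact: semicircle_pdf_ge0.
Qed.

Lemma semicircle_law_itv :
  semicircle_law t0 `[- (2 * s), 2 * s]%classic = 1%E.
Proof.
rewrite /semicircle_law -[RHS](integral_semicircle_pdf t0).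
rewrite [LHS]integral_mkcond; apply: eq_integral => x _.
rewrite patchE; case: ifPn => //; rewrite notin_setE/= in_itv/= => /negP.
by rewrite -ler_norml /semicircle_pdf => /negbTE ->.
Qed.

Lemma integral_semicircle_angle (h : R -> R) :
  {within `[- (2 * s), 2 * s], continuous h} ->
  (\int[leb]_(x in `[(- (2 * s))%R, (2 * s)%R]) (h x * semicircle_pdf t x)%:E =
   \int[leb]_(x in `[(- (pi / 2))%R, (pi / 2)%R])
     (h (2 * s * sin x)%R * (2 / pi * cos x ^+ 2))%:E)%E.
Proof.
move=> ch.
have p0 : 0 < pi :> R := pi_gt0 R.
pose F : R -> R := fun x => 2 * s * sin x.
have dF (x : R) : is_derive x (1 : R) F (2 * s * cos x).
  by rewrite /F; apply: is_derive_eq.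
have F'E : derive1 F = (fun x => 2 * s * cos x).
  by apply/funext => x; rewrite derive1E derive_val.
have cF' : continuous (fun x : R => 2 * s * cos x).
  by move=> x; apply: cvgMl_tmp; exact: continuous_cos.
have cF : continuous F by move=> x; apply: cvgMl_tmp; exact: continuous_sin.
have Fa : F (- (pi / 2)) = - (2 * s) by rewrite /F sinN sin_pihalf mulrN1.
have Fb : F (pi / 2) = 2 * s by rewrite /F sin_pihalf mulr1.
rewrite -{1}Fa -{1}Fb.
rewrite (integration_by_substitution_increasing
  (G := fun x => h x * semicircle_pdf t x)); last 7 first.
- lra.
- move=> x y; rewrite !in_itv/= => xi yi xy; rewrite /F ltr_pM2l ?mulr_gt0//.
  by rewrite ltr_sin// in_itv.
- by rewrite F'E => x _; exact: cF'.
- by rewrite F'E; apply/cvg_ex; eexists; apply: cvg_at_right_filter; exact: cF'.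
- by rewrite F'E; apply/cvg_ex; eexists; apply: cvg_at_left_filter; exact: cF'.
- split; first by move=> x _; exact: ex_derive.
    by apply: cvg_at_right_filter; exact: cF.
  by apply: cvg_at_left_filter; exact: cF.
- rewrite Fa Fb => x; apply: cvgM; first exact: ch.
  by apply: continuous_subspaceT; exact: continuous_semicircle_pdf.
apply: eq_integral => x; rewrite inE/= in_itv/= => xi; congr (_%:E).
change (h (F x) * semicircle_pdf t (F x) * derive1 F x =
        h (F x) * (2 / pi * cos x ^+ 2)).
rewrite -mulrA F'E; congr (_ * _).
rewrite semicircle_pdfE//= /F.
have -> : 4 * t - (2 * s * sin x) ^+ 2 = (2 * s * cos x) ^+ 2.
  by rewrite -s2 !exprMn cos2sin2; ring.
rewrite sqrtr_sqr ger0_norm; last first.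
  by rewrite mulr_ge0 ?cos_ge0_pihalf// mulr_ge0// ltW.
rewrite -s2; move: (pi : R) p0 (cos x) => p p0' c; field.
by rewrite !gt_eqF.
Qed.

(** The half-circle Poisson kernel is the derivative of
    [x + 2 * atan (q * cos x / (1 + q * sin x))], an antiderivative without
    branch jump on the half circle; polynomial division in [sin x] reduces the
    integrand to that kernel. *)
Lemma integral_cos2_poisson (q : R) : 0 < q < 1 ->
  (\int[leb]_(x in `[(- (pi / 2))%R, (pi / 2)%R])
     (cos x ^+ 2 / (1 + 2 * q * sin x + q ^+ 2))%:E = (pi / 2)%:E)%E.
Proof.
move=> /andP[q0 q1]; have p0 : 0 < pi :> R := pi_gt0 R.
have d0 (x : R) : 0 < 1 + q * sin x.
  have := sin_geN1 x; nra.
have D0 (x : R) : 0 < 1 + 2 * q * sin x + q ^+ 2.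
  by have := sin_geN1 x; have := sin_le1 x; nra.
pose A : R -> R := fun x => q * cos x / (1 + q * sin x).
pose Psi : R -> R := fun x =>
  (2 * q ^+ 2 * x + 2 * q * cos x - 2 * (1 - q ^+ 2) * atan (A x)) / (4 * q ^+ 2).
pose g : R -> R := fun x => cos x ^+ 2 / (1 + 2 * q * sin x + q ^+ 2).
have dA (x : R) : is_derive x (1 : R) A (- (q * sin x + q ^+ 2) / (1 + q * sin x) ^+ 2).
  have dn : is_derive x (1 : R) (fun x : R => q * cos x) (- (q * sin x)).
    by apply: is_derive_eq; rewrite /GRing.scale/=; ring.
  have dd : is_derive x (1 : R) (fun x : R => 1 + q * sin x) (q * cos x).
    by apply: is_derive_eq; rewrite /GRing.scale/=; ring.
  have dV := @is_deriveV R (fun x => 1 + q * sin x) x _ 1 (lt0r_neq0 (d0 x)) dd.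
  have dM := is_deriveM dn dV.
  apply: (is_derive_eq dM); rewrite /GRing.scale/=.
  have cE : cos x ^+ 2 = 1 - sin x ^+ 2 by rewrite cos2sin2.
  have := lt0r_neq0 (d0 x).
  move: cE; set S := sin x; set C := cos x => cE nz.
  transitivity (- (q * S * (1 + q * S) + q ^+ 2 * C ^+ 2) / (1 + q * S) ^+ 2).
    by field.
  rewrite cE; congr (_ / _); ring.
have dPsi (x : R) : is_derive x (1 : R) Psi (g x).
  have dat : is_derive x (1 : R) (atan \o A)
     ((1 + A x ^+ 2)^-1 * (- (q * sin x + q ^+ 2) / (1 + q * sin x) ^+ 2)).
    exact: is_derive1_comp.
  rewrite /Psi; apply: is_derive_eq; rewrite /GRing.scale/= /g /A.
  have cE : cos x ^+ 2 = 1 - sin x ^+ 2 by rewrite cos2sin2.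
  have := lt0r_neq0 (d0 x); have := lt0r_neq0 (D0 x).
  move: cE; set S := sin x; set C := cos x => cE nz nz'.
  rewrite exprMn exprVn exprMn cE.
  have -> : 1 + q ^+ 2 * (1 - S ^+ 2) / (1 + q * S) ^+ 2 =
     (1 + 2 * q * S + q ^+ 2) / (1 + q * S) ^+ 2 by field.
  by field; rewrite nz nz' gt_eqF.
have cPsi : continuous Psi.
  by move=> x; apply/differentiable_continuous/derivable1_diffP; exact: ex_derive.
rewrite (@continuous_FTC2 _ g Psi)//.
- rewrite /Psi /A -EFinB cosN cos_pihalf !mulr0 !mul0r atan0; congr (_%:E).
  move: (pi : R) p0 => p p0'; field.
  by rewrite gt_eqF.
- lra.
- apply: continuous_subspaceT => x; apply: cvgM.
    apply: (@cvg_comp _ _ _ cos (fun x => x ^+ 2)); first exact: continuous_cos.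
    exact: exprn_continuous.
  apply: cvgV; first exact: lt0r_neq0.
  apply: cvgD; last exact: cvg_cst.
  apply: cvgD; first exact: cvg_cst.
  by apply: cvgMl_tmp; exact: continuous_sin.
- split; first by move=> x _; exact: ex_derive.
    by apply: cvg_at_right_filter; exact: cPsi.
  by apply: cvg_at_left_filter; exact: cPsi.
- by move=> x _; rewrite derive1E derive_val.
Qed.


(** In the angular variable, with [q = - (s * w)], the denominator becomes
    [- w^-1 * (1 + 2 * q * sin x + q ^+ 2)]. *)
Lemma cauchy_transform_semicircle (w : R) : w < 0 -> - s^-1 < w ->
  t * w + w^-1 < - (2 * s) /\
  cauchy_transform (semicircle_law t0) (t * w + w^-1) = w.
Proof.
move=> w0 sw; set z := t * w + w^-1.
pose q := - (s * w).
have q0 : 0 < q by rewrite /q oppr_gt0 nmulr_llt0.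
have q1 : q < 1.
  by rewrite /q -mulrN -(divff (lt0r_neq0 s0)) ltr_pM2l// ltrNl.
have zlt : z < - (2 * s).
  rewrite -subr_gt0; have -> : - (2 * s) - z = (1 - q) ^+ 2 * (- w^-1).
    by rewrite /z /q -s2; field; rewrite lt_eqF.
  by rewrite mulr_gt0 ?oppr_gt0 ?invr_lt0// exprn_gt0// subr_gt0.
split => //.
have mass := semicircle_law_itv.
set D : set R := `[- (2 * s), 2 * s]%classic in mass *.
have mD : measurable D by exact: measurable_itv.
pose k x := `|x - z|^-1.
have xz x : D x -> 0 < x - z.
  by rewrite /D/= in_itv/= subr_gt0 => /andP[+ _]; exact: lt_le_trans.
have kE x : D x -> k x = (x - z)^-1 by move=> /xz xz0; rewrite /k gtr0_norm.
have mk (A : set R) : measurable_fun A k.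
  by apply: measurable_funV; apply: measurableT_comp => //; exact: measurable_funB.
have ki : (semicircle_law t0).-integrable D (EFin \o k).
  apply: (@bounded_Rintegrable _ _ _ mD mass _ (- (2 * s) - z)^-1) => [|x Dx].
    exact: mk.
  rewrite kE// gtr0_norm ?invr_gt0 ?xz// lef_pV2 ?posrE; last 2 first.
  - exact: xz.
  - by rewrite subr_gt0.
  by move: Dx; rewrite /D/= in_itv/= lerD2r => /andP[].
have kint : \int[semicircle_law t0]_(x in D) k x = - w.
  rewrite /Rintegral (ge0_integral_density semicircle_has_density)//; last 2 first.
  - by move=> x; rewrite lee_fin invr_ge0.
  - exact/measurable_EFinP.
  rewrite integral_semicircle_angle; last first.
    apply: continuous_in_subspaceT => x /set_mem Dx.
    apply: cvgV; first by rewrite normr_eq0 gt_eqF// xz.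
    by apply: cvg_norm; apply: cvgB; [exact: cvg_id|exact: cvg_cst].
  rewrite (eq_integral (fun x : measurableTypeR R => (- w * (2 / pi))%:E *
      (cos x ^+ 2 / (1 + 2 * q * sin x + q ^+ 2))%:E)%E); last first.
    move=> x; rewrite inE/= in_itv/= => xi; rewrite -EFinM; congr (_%:E).
    have Dx : D (2 * s * sin x).
      rewrite /D/= in_itv/= -ler_norml normrM gtr0_norm ?mulr_gt0//.
      by rewrite ler_piMr ?mulr_ge0 ?(ltW s0)// ler_norml sin_geN1 sin_le1.
    rewrite kE//; have := xz _ Dx.
    have -> : 2 * s * sin x - z = (- w^-1) * (1 + 2 * q * sin x + q ^+ 2).
      by rewrite /z /q -s2; field; rewrite lt_eqF.
    rewrite pmulr_rgt0 ?oppr_gt0 ?invr_lt0// => P0.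
    move: (pi_gt0 R) P0; move: (pi : R) => p p0.
    set P := 1 + _ + _ => P0; field.
    by rewrite (ltr0_neq0 w0) !lt0r_neq0.
  rewrite integralZl//; last first.
    apply: continuous_compact_integrable; first exact: segment_compact.
    apply: continuous_subspaceT => x; apply: cvgM.
      apply: (@cvg_comp _ _ _ cos (fun x => x ^+ 2)); first exact: continuous_cos.
      exact: exprn_continuous.
    apply: cvgV.
      by rewrite gt_eqF//; have := sin_geN1 x; have := sin_le1 x; nra.
    apply: cvgD; last exact: cvg_cst.
    apply: cvgD; first exact: cvg_cst.
    by apply: cvgMl_tmp; exact: continuous_sin.
  rewrite integral_cos2_poisson ?q0// -EFinM/=.
  by move: (pi_gt0 R); move: (pi : R) => p p0; field; rewrite gt_eqF.
rewrite (cauchy_transform_itv mass).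
rewrite (@eq_Rintegral _ _ _ _ _ (fun x => -1 * k x)).
  by rewrite RintegralZl// kint mulN1r opprK.
by move=> x /set_mem Dx; rewrite kE// mulN1r -invrN opprB.
Qed.

Lemma R_transform_semicircle :
  \forall w \near (0 : R)^'-, R_transform (semicircle_law t0) w = t * w.
Proof.
have sub := msupport_sub_itv semicircle_law_itv.
have [x0 Sx0] := msupport_neq0 (semicircle_law t0).
have ledge : - (2 * s) <= left_edge (semicircle_law t0).
  apply: lb_le_inf; first by exists x0.
  by move=> x /sub; rewrite /= in_itv/= => /andP[].
have bdd : bounded_set (msupport (semicircle_law t0)).
  exists (2 * s); split; first by rewrite num_real.
  move=> M sM x /sub; rewrite /= in_itv/= -ler_norml => /le_trans; apply.
  exact: ltW.
near=> w.
have w0 : w < 0 by near: w; exact: nbhs_left_lt.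
have sw : - s^-1 < w by near: w; apply: nbhs_left_gt; rewrite oppr_lt0 invr_gt0.
have [zlt gE] := cauchy_transform_semicircle w0 sw.
rewrite /R_transform -{1}gE cauchy_inverse_left//; first by rewrite addrK.
exact: lt_le_trans zlt ledge.
Unshelve. all: by end_near. Qed.

End semicircle_transform.

(** * Behaviour of the subordination function at the left edge *)

Section imaginary_part.
Context {R : realType} (mu : probability R R) (a b : R).
Let D : set R := `[a, b]%classic.
Hypothesis muD1 : mu D = 1%E.
Let mD : measurable D. Proof. exact: measurable_itv. Qed.
Implicit Types (z : R[i]) (d : R).

(** The second moment of the resolvent; up to sign it is the ratio of the
    imaginary part of the Stieltjes transform to that of [z]. *)
Definition square_transform z : R :=
  \int[mu]_(x in D) (normc (z - x%:C) ^+ 2)^-1.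

Lemma away_Im z : away a b `|Im z| z.
Proof.
by move=> x _; rewrite -(Im_sub_real z x) normc_Im.
Qed.

Lemma away_left y : y < a -> away a b (a - y) y%:C.
Proof.
move=> ya x Dx; have /andP[ax _] : a <= x <= b by move: Dx; rewrite /= in_itv.
rewrite -rmorphB normc_real distrC ger0_norm ?lerD2r//.
by rewrite subr_ge0 (le_trans (ltW ya)).
Qed.

Lemma measurable_square z : measurable_fun D (fun x => (normc (z - x%:C) ^+ 2)^-1).
Proof.
apply: measurable_funV; have [rf jf _] := bmeas_sub a b z.
under eq_fun do rewrite normc_sqrE.
by apply: measurable_funD; exact: measurable_funX.
Qed.

Lemma integrable_square d z : 0 < d -> away a b d z ->
  mu.-integrable D (EFin \o (fun x => (normc (z - x%:C) ^+ 2)^-1)).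
Proof.
move=> d0 dz; apply: (@bounded_Rintegrable _ _ _ mD muD1 _ (d ^+ 2)^-1).
  exact: measurable_square.
move=> x Dx; have nd := dz x Dx; have n0 := lt_le_trans d0 nd.
rewrite ger0_norm ?invr_ge0 ?sqr_ge0//.
by rewrite lef_pV2 ?posrE ?exprn_gt0// lerXn2r// nnegrE ltW.
Qed.

Lemma square_transform_ge0 z : 0 <= square_transform z.
Proof. by apply: Rintegral_ge0 => x _; rewrite invr_ge0 sqr_ge0. Qed.

Lemma Im_stieltjes d z : 0 < d -> away a b d z ->
  Im (stieltjes mu a b z) = - (Im z * square_transform z).
Proof.
move=> d0 dz; rewrite -mulNr -RintegralZl//; last exact: integrable_square dz.
transitivity (\int[mu]_(x in D) Im (z - x%:C)^-1) => //.
apply: eq_Rintegral => x _; apply: etrans (Im_invc _) _.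
by rewrite Im_sub_real mulNr.
Qed.

(** Markov's inequality for the weight [1 / |z - x| ^ 2], which is at least
    [1 / c ^ 2] on [A]. *)
Lemma markov_square d z (A : set R) c : 0 < d -> away a b d z -> measurable A ->
  (forall x, A x -> D x -> normc (z - x%:C) <= c) ->
  fine (mu A) / c ^+ 2 <= square_transform z.
Proof.
move=> d0 dz mA Ac; set g := fun x => (normc (z - x%:C) ^+ 2)^-1.
have c2 : 0 <= (c ^+ 2)^-1 by rewrite invr_ge0 sqr_ge0.
have mDA : measurable (D `&` A) by exact: measurableI.
have muA : mu A = mu (A `&` D).
  have m0 : mu (A `\` D) = 0%E.
    apply/eqP; rewrite eq_le measure_ge0 andbT setDE.
    have mC : measurable (~` D) by exact: measurableC.
    have mC0 : mu (~` D) = 0%E by rewrite probability_setC// muD1 subee.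
    by rewrite -mC0; exact: measureIr mA mC.
  transitivity (mu (A `\` D) + mu (A `&` D))%E; last by rewrite m0 add0e.
  exact: measureDI.
have ig := integrable_square d0 dz; have mg := measurable_square z.
have muf : mu (A `&` D) \is a fin_num.
  by apply: fin_num_measure; exact: measurableI.
have If : (\int[mu]_(x in D) (g x)%:E)%E \is a fin_num.
  exact: integrable_fin_num ig.
rewrite -lee_fin EFinM muA fineK// /square_transform /Rintegral fineK//.
rewrite muleC -integral_cst; last exact: measurableI.
apply: (@le_trans _ _ (\int[mu]_(x in A `&` D) (g x)%:E)%E).
  apply: ge0_le_integral => //.
  - exact: measurableI.
  - by apply/measurable_EFinP; apply: measurable_funS mg => //; exact: subIsetr.
  move=> x [Ax Dx]; rewrite lee_fin; have nd := lt_le_trans d0 (dz x Dx).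
  have nc := Ac x Ax Dx; have c0 := lt_le_trans nd nc.
  by rewrite lef_pV2 ?posrE ?exprn_gt0// lerXn2r// nnegrE ltW.
apply: ge0_subset_integral => //; first exact: measurableI.
- exact/measurable_EFinP.
- by move=> x _; rewrite lee_fin invr_ge0 sqr_ge0.
Qed.

End imaginary_part.

(** Bisecting the interval [n] times improves the bound by [2 ^- n]. *)
Lemma quadratic_mass_null (R : realType) (mu : probability R R) (C a b : R) :
  a < b -> 0 <= C ->
  (forall x y, a <= x -> x < y -> y <= b ->
     fine (mu `[x, y]%classic) <= C * (y - x) ^+ 2) ->
  mu `[a, b]%classic = 0%E.
Proof.
move=> ab C0 mC.
have mI (x y : R) : measurable (`[x, y]%classic : set R) by exact: measurable_itv.
have key n : forall x y, a <= x -> x < y -> y <= b ->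
    fine (mu `[x, y]%classic) <= C * (y - x) ^+ 2 / 2 ^+ n.
  elim: n => [|n ih] x y ax xy yb; first by rewrite expr0 divr1 mC.
  pose m := (x + y) / 2.
  have xm : x < m by rewrite /m; lra.
  have my : m < y by rewrite /m; lra.
  apply: (@le_trans _ _ (fine (mu `[x, m]%classic) + fine (mu `[m, y]%classic))).
    rewrite -fineD ?fin_num_measure//; apply: fine_le.
    - exact: fin_num_measure.
    - by rewrite fin_numD !fin_num_measure.
    apply: le_trans (measureU2 _ _ _) => //.
    apply: le_measure; rewrite ?inE//; first exact: measurableU.
    move=> z /=; rewrite !in_itv/= => /andP[xz zy].
    by have [zm|/ltW mz] := leP z m; [left; rewrite xz|right; rewrite mz].
  have := ih x m ax xm (le_trans (ltW my) yb).
  have := ih m y (le_trans ax (ltW xm)) my yb.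
  have -> : C * (y - x) ^+ 2 / 2 ^+ n.+1 =
    C * (m - x) ^+ 2 / 2 ^+ n + C * (y - m) ^+ 2 / 2 ^+ n.
    have : (2 : R) ^+ n != 0 by rewrite expf_neq0.
    by rewrite /m [2 ^+ n.+1]exprS; move: (2 ^+ n) => p p0; field.
  lra.
have cv : (C * (b - a) ^+ 2 / 2 ^+ n) @[n --> \oo] --> (0 : R).
  rewrite -[X in _ --> X](mulr0 (C * (b - a) ^+ 2)); apply: cvgMl_tmp.
  under eq_fun do rewrite -exprVn.
  by apply: cvg_expr; rewrite ger0_norm ?invr_ge0// invf_lt1// ltr1n.
have : fine (mu `[a, b]%classic) <= 0.
  rewrite -(cvg_lim _ cv)//; apply: limr_ge; first by apply/cvg_ex; eexists; exact: cv.
  by apply: nearW => n; exact: key.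
move=> m0; rewrite -[LHS]fineK ?fin_num_measure//; congr (_%:E).
by apply/eqP; rewrite eq_le m0 fine_ge0.
Qed.

Section edge.
Context {R : realType} (muT muD : probability R R) (aT bT aD bD t : R).
Hypotheses (t0 : 0 < t)
           (muT1 : muT `[aT, bT]%classic = 1%E)
           (muD1 : muD `[aD, bD]%classic = 1%E).
Hypothesis aD_mass : forall e : R, 0 < e -> (0 < muD `[(aD - 1)%R, (aD + e)%R]%classic)%E.

Local Notation GT := (stieltjes muT aT bT).
Local Notation GD := (stieltjes muD aD bD).
Local Notation om := (omega muT aT bT t).
Local Notation gap := (subordination_gap muT muD aT bT aD bD t).
Local Notation regular := (regular_point muT aT bT aD bD t).
Local Notation AT := (square_transform muT aT bT).
Local Notation AD := (square_transform muD aD bD).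

Definition omega_real y := y - t * cauchy_transform muT y.
Local Notation omr := omega_real.

Hypothesis near_infinity : exists2 K, K < aT & forall y, y < K ->
  omr y < aD /\ cauchy_transform muD (omr y) = cauchy_transform muT y.

Lemma omegaE y : om y%:C = (omr y)%:C.
Proof. by rewrite /omega stieltjes_real// -rmorphM -rmorphB. Qed.

Lemma gapE y :
  gap y%:C = (cauchy_transform muT y - cauchy_transform muD (omr y))%:C.
Proof. by rewrite /subordination_gap omegaE !stieltjes_real// rmorphB. Qed.

Lemma Im_omega (z : R[i]) : 0 < Im z -> Im (om z) = Im z * (1 + t * AT z).
Proof.
move=> z0; have dz := @away_Im _ aT bT z.
transitivity (Im z - Im (t%:C * GT z)); first exact: raddfB.
rewrite Im_mulc (_ : Im t%:C = 0)// mul0r addr0 (_ : Re t%:C = t)//.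
by rewrite (Im_stieltjes muT1 _ dz) ?normr_gt0 ?gt_eqF//; ring.
Qed.

Lemma Im_omega_ge (z : R[i]) : 0 < Im z -> Im z <= Im (om z).
Proof.
move=> z0; rewrite Im_omega// ler_peMr ?(ltW z0)// lerDl.
by rewrite mulr_ge0 ?(ltW t0)// square_transform_ge0.
Qed.

Lemma regular_up (z : R[i]) : 0 < Im z -> regular z.
Proof.
move=> z0; exists (Im z) => //; split.
  by have := @away_Im _ aT bT z; rewrite gtr0_norm.
have wz := Im_omega_ge z0; have := @away_Im _ aD bD (om z).
rewrite gtr0_norm ?(lt_le_trans z0)// => aw x Dx.
exact: le_trans wz (aw x Dx).
Qed.

Lemma regular_left y : y < aT -> omr y < aD -> regular y%:C.
Proof.
move=> ya wa; exists (Num.min (aT - y) (aD - omr y)).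
  by rewrite lt_min !subr_gt0 ya.
split=> x Dx.
  by apply: le_trans (away_left ya Dx); rewrite ge_min lexx.
by rewrite omegaE; apply: le_trans (away_left wa Dx); rewrite ge_min lexx orbT.
Qed.

Lemma gap_from_left p q : (forall y, y <= p -> y < aT /\ omr y < aD /\
    cauchy_transform muD (omr y) = cauchy_transform muT y) ->
  (forall s : R, 0 < s <= 1 -> regular (p%:C + s%:C * (q - p%:C))) ->
  gap q = 0.
Proof.
move=> left reg; apply: (gap_segment muT1 muD1 (p := p%:C)).
  move=> s /andP[]; rewrite le_eqVlt => /predU1P[<- _|s0 s1].
    have [pa [wa _]] := left p (lexx p).
    by rewrite rmorph0 mul0r addr0; exact: regular_left.
  by apply: reg; rewrite s0.
move=> e e0; exists (- (e / 2))%:C; split.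
- by rewrite -normc_gt0 normc_real normrN gtr0_norm; lra.
- by rewrite normc_real normrN gtr0_norm; lra.
- rewrite -rmorphD gapE; have [|_ [_ ->]] := left (p + - (e / 2)); first lra.
  by rewrite subrr rmorph0.
Qed.

(** Subordination holds on the real line near minus infinity and spreads along
    the segment from there to [z], all of whose points are regular since [omega]
    does not decrease imaginary parts. *)
Lemma subordination_up (z : R[i]) : 0 < Im z -> GT z = GD (om z).
Proof.
move=> z0; have [K KaT left] := near_infinity.
apply/eqP; rewrite -subr_eq0; apply/eqP.
apply: (@gap_from_left (K - 1)) => [y yK|s /andP[s0 s1]].
  by have [|wa gE] := left y; [lra|split; [lra|]].
apply: regular_up.
have -> : Im ((K - 1)%:C + s%:C * (z - (K - 1)%:C)) = s * Im z.
  by case: z {z0} => x y /=; ring.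
exact: mulr_gt0.
Qed.

(** Comparing imaginary parts in the subordination identity gives
    [AT z = (1 + t * AT z) * AD (om z)]. *)
Lemma square_transform_omega (z : R[i]) : 0 < Im z -> t * AD (om z) <= 1.
Proof.
move=> z0; have wz := Im_omega_ge z0; have w0 := lt_le_trans z0 wz.
have dz := @away_Im _ aT bT z; have dw := @away_Im _ aD bD (om z).
have nw : 0 < `|Im (om z)| by rewrite normr_gt0 gt_eqF.
have := Im_stieltjes muD1 nw dw.
rewrite -subordination_up// (Im_stieltjes muT1 _ dz) ?normr_gt0 ?gt_eqF//.
rewrite Im_omega// => /oppr_inj; rewrite -mulrA => /(mulfI (lt0r_neq0 z0)).
have := square_transform_ge0 muT aT bT z; have := square_transform_ge0 muD aD bD (om z).
set x := AD _; set y := AT _ => x0 y0 yE.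
have ty : 0 < 1 + t * y by rewrite ltr_wpDr// mulr_ge0// ltW.
by rewrite -(ler_pM2l ty) mulrCA -yE; lra.
Qed.

(** A small ball about [om y] captures the values of [om] slightly above [y],
    where the second moment of the resolvent is at most [1 / t]. *)
Lemma mass_near_omega (y h : R) : y < aT -> 0 < h ->
  t * fine (muD `[omr y - h, omr y + h]%classic) <= 4 * h ^+ 2.
Proof.
move=> ya h0; pose d := aT - y; have d0 : 0 < d by rewrite subr_gt0.
have dy : away aT bT d y%:C by exact: away_left.
pose M := d + `|t| * 4 / d.
have M0 : 0 < M by rewrite ltr_wpDr// mulr_ge0 ?invr_ge0 ?mulr_ge0// ltW.
pose e := Num.min (d / 2) (h * (d / M)).
have e0 : 0 < e by rewrite lt_min divr_gt0// mulr_gt0// divr_gt0.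
pose z := y%:C + (0 +i* e).
have z0 : 0 < Im z by rewrite /z/= add0r.
have ne : normc (0 +i* e) = e by rewrite /= expr0n/= add0r sqrtr_sqr gtr0_norm.
have ed : normc (0 +i* e) <= d / 2 by rewrite ne ge_min lexx.
have wz : normc (om z - (omr y)%:C) <= h.
  rewrite /z (omega_shift t muT1 d0 dy ed) omegaE addrC addKr normcM ne.
  have := normc_omega_remainder t muT1 0 d0 dy ed; rewrite expr1 -/M => oM.
  have eM : e <= h * (d / M) by rewrite ge_min lexx orbT.
  apply: (@le_trans _ _ (h * (d / M) * (M / d))).
    by rewrite ler_pM ?normc_ge0// ltW.
  have -> // : h * (d / M) * (M / d) = h by field; rewrite !gt_eqF.
have w0 : 0 < Im (om z) := lt_le_trans z0 (Im_omega_ge z0).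
have dw := @away_Im _ aD bD (om z).
have mI : measurable (`[omr y - h, omr y + h]%classic : set R) by exact: measurable_itv.
have nw : 0 < `|Im (om z)| by rewrite normr_gt0 gt_eqF.
have mk : fine (muD `[omr y - h, omr y + h]%classic) / (2 * h) ^+ 2 <= AD (om z).
  apply: (markov_square muD1 nw dw mI) => x Ax _.
  have /andP[xl xr] : omr y - h <= x <= omr y + h by move: Ax; rewrite /= in_itv.
  have -> : om z - x%:C = om z - (omr y)%:C + (omr y - x)%:C.
    by rewrite [X in _ = _ + X]rmorphB addrA subrK.
  apply: le_trans (le_normcD _ _) _; rewrite mulr2n mulrDl mul1r lerD//.
  by rewrite normc_real ler_norml; apply/andP; split; lra.
have tA := square_transform_omega z0.
have h2 : 0 < (2 * h) ^+ 2 by rewrite exprn_gt0// mulr_gt0.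
have -> : 4 * h ^+ 2 = (2 * h) ^+ 2 by ring.
rewrite -[leRHS]mul1r -ler_pdivrMr// -mulrA.
by apply: le_trans tA; rewrite ler_wpM2l// ltW.
Qed.

Lemma omega_real_ge y : y < aT -> y <= omr y.
Proof.
move=> ya; rewrite /omega_real lerDl oppr_ge0 pmulr_rle0//.
by rewrite ltW// (cauchy_transform_left_lt0 muT1).
Qed.

Lemma omega_real_increasing y y' : y < y' -> y' < aT -> omr y < omr y'.
Proof.
move=> yy' y'a; have ab := le_ab muT1.
have /andP[lo _] := cauchy_transform_diff muT1 yy' y'a.
have : 0 < cauchy_transform muT y - cauchy_transform muT y'.
  apply: lt_le_trans lo; rewrite divr_gt0 ?subr_gt0// exprn_gt0// subr_gt0.
  by rewrite (lt_le_trans yy')// (le_trans (ltW y'a)).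
by move=> g0; have := mulr_gt0 t0 g0; rewrite /omega_real; lra.
Qed.

Lemma omega_real_surj y1 u : y1 < aT -> u <= omr y1 ->
  exists2 y, y < aT & omr y = u.
Proof.
move=> y1a uy1; pose y0 := Num.min y1 (Num.min (aT - 1) (u - t)).
have y01 : y0 <= y1 by rewrite ge_min lexx.
have y0a : y0 <= aT - 1 by rewrite !ge_min lexx orbT.
have y0u : y0 <= u - t by rewrite !ge_min lexx !orbT.
have oy0 : omr y0 <= u.
  have /andP[lo _] : - (aT - y0)^-1 <= cauchy_transform muT y0 <= - (bT - y0)^-1.
    by apply: (cauchy_transform_left muT1); lra.
  have : (aT - y0)^-1 <= 1 by rewrite invf_le1; lra.
  move=> i1; have g1 : - 1 <= cauchy_transform muT y0 by lra.
  by have := ler_wpM2l (ltW t0) g1; rewrite /omega_real; lra.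
have [||y yI yu] := @IVT _ omr y0 y1 u y01.
- apply: continuous_in_subspaceT => y; rewrite inE/= in_itv/= => /andP[_ yy1].
  apply: cvgB; first exact: cvg_id.
  apply: cvgMl_tmp; apply: (cauchy_transform_continuous muT1).
  exact: le_lt_trans y1a.
- by rewrite ge_min oy0/= le_max uy1 orbT.
exists y => //; move: yI; rewrite in_itv/= => /andP[_ yy1].
exact: le_lt_trans y1a.
Qed.

(** If [omr] crossed the left edge of [muD], the mass of every small interval
    around the points it reaches would be quadratically small, so [muD] would
    not charge a neighborhood of its own left edge. *)
Lemma omega_real_le_edge y : y < aT -> omr y <= aD.
Proof.
move=> ya; rewrite leNgt; apply/negP => wa.
pose e := omr y - aD; have e0 : 0 < e by rewrite subr_gt0.
have := aD_mass e0; rewrite (@quadratic_mass_null _ _ t^-1) ?ltxx//.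
- by rewrite /e; lra.
- by rewrite invr_ge0 ltW.
move=> x x' ax xx' x'e; pose h := (x' - x) / 2.
have h0 : 0 < h by rewrite divr_gt0// subr_gt0.
have [y' y'a ymid] : exists2 y', y' < aT & omr y' = (x + x') / 2.
  by apply: (omega_real_surj ya); move: x'e; rewrite /e; lra.
have := mass_near_omega y'a h0; rewrite ymid.
have -> : (x + x') / 2 - h = x by rewrite /h; field.
have -> : (x + x') / 2 + h = x' by rewrite /h; field.
have -> : 4 * h ^+ 2 = (x' - x) ^+ 2 by rewrite /h; field.
by rewrite ler_pdivlMl.
Qed.

Lemma omega_real_lt_edge y : y < aT -> omr y < aD.
Proof.
move=> ya; have ym : y < (y + aT) / 2 by lra.
have mb : (y + aT) / 2 < aT by lra.
exact: lt_le_trans (omega_real_increasing ym mb) (omega_real_le_edge mb).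
Qed.

(** Now that [omr] is known to stay left of the support of [muD], every real
    point left of the support of [muT] is regular. *)
Lemma subordination_left y : y < aT -> GT y%:C = GD (om y%:C).
Proof.
move=> ya; have [K KaT left] := near_infinity.
apply/eqP; rewrite -subr_eq0; apply/eqP.
apply: (@gap_from_left (K - 1)) => [x xK|s /andP[s0 s1]].
  by have [|wa gE] := left x; [lra|split; [lra|]].
rewrite -rmorphB -rmorphM -rmorphD; set r := _ + _.
have ra : r < aT by rewrite /r; nra.
by apply: regular_left => //; exact: omega_real_lt_edge.
Qed.

(** Both transforms are evaluated at subordinated points, so the increment of
    [w + t * GD w] between a point above the axis and a real point left of the
    support factors through [1 - t * I], where [I] is the integral of the
    product of two resolvents.  The real resolvent has a sign, which bounds the
    imaginary part of [I] below by a multiple of [Im (om z)]. *)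
Lemma Im_omega_sqr_le (z : R[i]) (y L L' : R) : 0 < Im z -> y < aT ->
  (forall x, aD <= x <= bD -> normc (om z - x%:C) <= L) ->
  bD - omr y <= L' ->
  t * Im (om z) ^+ 2 <= L ^+ 2 * L' * normc (z - y%:C).
Proof.
move=> z0 ya wL uL'; set w := om z; set u := omr y.
have w0 : 0 < Im w := lt_le_trans z0 (Im_omega_ge z0).
have ua : u < aD by exact: omega_real_lt_edge.
have ab := le_ab muD1.
have nw : 0 < `|Im w| by rewrite normr_gt0 gt_eqF.
have dw := @away_Im _ aD bD w.
have au0 : 0 < aD - u by rewrite subr_gt0.
have du := @away_left _ aD bD u ua.
pose ker x := (w - x%:C)^-1 * (u%:C - x%:C)^-1.
have bw := bmeas_kernel nw dw; have bu := bmeas_kernel au0 du.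
have bk : bmeas `[aD, bD]%classic ker by exact: (bmeasM bw bu).
pose I := cint muD `[aD, bD]%classic ker.
have GDdiff : GD w - GD u%:C = - (w - u%:C) * I.
  rewrite /I -cintM// -cintB//; apply: eq_cint => x Dx; rewrite /ker.
  have := away_neq0 nw dw Dx; have := away_neq0 au0 du Dx.
  by move=> n1 n2; field; rewrite n1 n2.
have zyE : z - y%:C = (w - u%:C) * (1 - t%:C * I).
  have zE : z = w + t%:C * GD w by rewrite /w -subordination_up// /omega subrK.
  have yE : y%:C = u%:C + t%:C * GD u%:C.
    by rewrite /u -omegaE -subordination_left// /omega subrK.
  transitivity ((w - u%:C) + t%:C * (GD w - GD u%:C)).
    by rewrite {1}zE {1}yE; ring.
  by rewrite GDdiff; ring.
have L0 : 0 < L.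
  apply: (lt_le_trans w0); apply: le_trans (wL aD _); last by rewrite lexx ab.
  apply: le_trans (ler_norm _) _.
  rewrite -(Im_sub_real w aD).
  exact: normc_Im.
have L'0 : 0 < L' by apply: lt_le_trans uL'; rewrite subr_gt0 (lt_le_trans ua).
have ImI : Im w / (L ^+ 2 * L') <= Im I.
  have mker : measurable_fun `[aD, bD]%classic (fun x => Im (ker x)) by case: bk.
  have [_ _ [B kB]] := bk.
  have /andP[+ _] : Im w / (L ^+ 2 * L') <=
      \int[muD]_(x in `[aD, bD]%classic) Im (ker x) <= B; last by [].
  apply: (Rintegral_bounds muD1) => // x Dx.
  rewrite (le_trans (ler_norm _) (le_trans (normc_Im _) (kB _ Dx))) andbT.
  have xI : aD <= x <= bD by move: Dx; rewrite /= in_itv.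
  have /andP[ax xb] := xI.
  have nx : 0 < normc (w - x%:C) by apply: lt_le_trans nw (dw _ Dx).
  have xu : 0 < x - u by rewrite subr_gt0 (lt_le_trans ua).
  have -> : Im (ker x) = Im w * ((normc (w - x%:C) ^+ 2) * (x - u))^-1.
    rewrite /ker -rmorphB -fmorphV Im_mulc (_ : Im ((u - x)^-1)%:C = 0)//.
    rewrite mulr0 add0r (_ : Re ((u - x)^-1)%:C = (u - x)^-1)// Im_invc.
    rewrite Im_sub_real.
    rewrite (_ : (u - x)^-1 = - (x - u)^-1); last by rewrite -invrN opprB.
    by rewrite mulrNN -mulrA -invfM.
  rewrite ler_wpM2l ?(ltW w0)// lef_pV2 ?posrE ?mulr_gt0 ?exprn_gt0//.
  apply: ler_pM; [by rewrite sqr_ge0|exact: ltW| |].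
    by rewrite lerXn2r ?nnegrE ?(ltW L0) ?normc_ge0// wL.
  by apply: le_trans uL'; rewrite lerD2r.
have LL : 0 < L ^+ 2 * L' by rewrite mulr_gt0 ?exprn_gt0.
have Im0 : 0 <= Im I by apply: le_trans ImI; rewrite divr_ge0// ltW.
rewrite zyE normcM.
have n1 : Im w <= normc (w - u%:C).
  apply: le_trans (ler_norm _) _.
  rewrite -(Im_sub_real w u).
  exact: normc_Im.
have n2 : t * Im I <= normc (1 - t%:C * I).
  apply: le_trans (normc_Im _).
  have -> : Im (1 - t%:C * I) = - (t * Im I) by case: (I) => p q /=; ring.
  by rewrite normrN ger0_norm// mulr_ge0// ltW.
apply: (@le_trans _ _ (L ^+ 2 * L' * (Im w * (t * Im I)))).
  have -> : L ^+ 2 * L' * (Im w * (t * Im I)) = t * Im w * (L ^+ 2 * L' * Im I) by ring.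
  have -> : t * Im w ^+ 2 = t * Im w * (L ^+ 2 * L' * (Im w / (L ^+ 2 * L'))).
    by field; rewrite ?expf_neq0 !gt_eqF.
  by rewrite ler_wpM2l ?mulr_ge0 ?(ltW t0) ?(ltW w0)// ler_wpM2l// ltW.
by rewrite ler_wpM2l ?(ltW LL)// ler_pM ?(ltW w0)// mulr_ge0// ltW.
Qed.

(** Either [om z] is close to the support of [muD], or its transform there is
    at most [2] and [om z = z - t * GD (om z)] is close to [z]. *)
Lemma omega_bounded (z : R[i]) (x Z B : R) : 0 < Im z -> normc z <= Z ->
  (forall x, aD <= x <= bD -> `|x| <= B) -> aD <= x <= bD ->
  normc (om z - x%:C) <= Z + 2 * t + 2 * B + 1.
Proof.
have tpos : 0 < t := t0.
have sum1 (p q : R) : 0 <= Z -> p <= B + 1 -> q <= B ->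
  p + q <= Z + 2 * t + 2 * B + 1 by move=> *; lra.
have sum2 (p q : R) : 0 <= B -> p <= Z + 2 * t -> q <= B ->
  p + q <= Z + 2 * t + 2 * B + 1 by move=> *; lra.
have dif (p q r : R) : p - q <= r -> B + 1 < p -> q <= B -> 1 <= r.
  by move=> *; lra.
move=> z0 zZ xB xI.
have Z0 : 0 <= Z by apply: le_trans zZ; exact: normc_ge0.
have B0 : 0 <= B by apply: le_trans (xB x xI).
set w := om z; have [wB|Bw] := leP (normc w) (B + 1).
  by apply: le_trans (le_normcB _ _) _; apply: sum1 => //; rewrite normc_real xB.
have dw : away aD bD 1 w.
  move=> x' Dx'; have x'I : aD <= x' <= bD by move: Dx'; rewrite /= in_itv.
  apply: dif (ler_normc_subl w (- x'%:C)) Bw _.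
  by rewrite normcN normc_real xB.
have G2 : normc (GD w) <= 2 * 1.
  apply: normc_cint => //; first exact: (bmeas_kernel ltr01 dw).
  by move=> x' Dx'; rewrite normcV invf_le1 ?dw// (lt_le_trans ltr01)// dw.
have wle : normc w <= Z + 2 * t.
  have -> : w = z - t%:C * GD w by rewrite /w -subordination_up.
  apply: le_trans (le_normcB _ _) _; rewrite lerD// normcM normc_real gtr0_norm//.
  by rewrite mulrC ler_wpM2r ?(ltW t0)//; lra.
by apply: le_trans (le_normcB _ _) _; apply: sum2 => //; rewrite normc_real xB.
Qed.

End edge.

(** * The square root bound *)

Section subordinated_density.
Context {R : realType} (muD : probability R R) (t : R) (t0 : 0 < t)
  (mut : probability R R).
Hypotheses (bD : bounded_set (msupport muD)) (bT : bounded_set (msupport mut)).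
Hypothesis conv : \forall w \near (0 : R)^'-,
  R_transform mut w = R_transform (semicircle_law t0) w + R_transform muD w.

(** At a real point [y] far to the left, [w = cauchy_transform mut y] is a small
    negative number, and the additivity of the R-transforms at [w] reads
    [y = t * w + cauchy_inverse muD w]. *)
Lemma subordination_near_infinity : exists2 K, K < left_edge mut & forall y, y < K ->
  omega_real mut t y < left_edge muD /\
  cauchy_transform muD (omega_real mut t y) = cauchy_transform mut y.
Proof.
have muT1 := support_itv_full bT.
have lr := left_le_right bT.
have [e /= e0 near0] : \forall w \near (0 : R)^'-,
   [/\ R_transform mut w = R_transform (semicircle_law t0) w + R_transform muD w,
    R_transform (semicircle_law t0) w = t * w,
    cauchy_inverse muD w < left_edge muD &
    cauchy_transform muD (cauchy_inverse muD w) = w].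
  near=> w.
  have [i1 i2] : cauchy_inverse muD w < left_edge muD /\
    cauchy_transform muD (cauchy_inverse muD w) = w.
    by near: w; exact: cauchy_inverseK.
  split => //; near: w; [exact: conv|exact: R_transform_semicircle].
(* Left of this point the transform of mut lies in the interval from -e to 0. *)
exists (left_edge mut - e^-1); first by rewrite ltrBlDr ltrDl invr_gt0.
move=> y yK; have yl : y < left_edge mut.
  by apply: lt_trans yK _; rewrite ltrBlDr ltrDl invr_gt0.
have w0 := cauchy_transform_left_lt0 muT1 yl.
have /andP[lo _] := cauchy_transform_left muT1 yl.
set w := cauchy_transform mut y in w0 lo *.
have we : `|0 - w| < e.
  rewrite sub0r normrN ltr0_norm//; apply: (@le_lt_trans _ _ (left_edge mut - y)^-1).
    by rewrite lerNl.
  rewrite -[ltRHS]invrK ltf_pV2 ?posrE ?invr_gt0 ?subr_gt0//.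
  by rewrite ltrBrDl -ltrBrDr.
have [E1 E2 i1 i2] := near0 w we w0.
have -> : omega_real mut t y = cauchy_inverse muD w.
  move: E1; rewrite E2 /R_transform /w cauchy_inverse_left// -/w /omega_real -/w.
  by move=> E1; lra.
by [].
Unshelve. all: by end_near. Qed.

(** Integrating only over [`]x - eta, x + eta[] already recovers the density up
    to a constant factor. *)
Lemma density_le_square_transform (f : R -> R) (x m eta : R) :
  has_density mut f -> 0 < eta -> 0 <= m ->
  (forall s, `|s - x| < eta -> m <= f s) ->
  m <= 2 * eta *
    square_transform mut (left_edge mut) (right_edge mut) (x +i* eta).
Proof.
move=> [mf [f0 fE]] eta0 m0 mfs.
have muT1 := support_itv_full bT.
have dz := @away_Im _ (left_edge mut) (right_edge mut) (x +i* eta).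
set A : set R := `]x - eta, x + eta[%classic.
have mA : measurable A by exact: measurable_itv.
have nz : 0 < `|Im (x +i* eta)| by rewrite /= normr_gt0 gt_eqF.
have Ad s : A s -> `|s - x| < eta.
  rewrite /A/= in_itv/= ltr_norml => /andP[l r].
  by apply/andP; split; lra.
have lA : (@lebesgue_measure R) A = (2 * eta)%:E.
  transitivity ((x + eta)%:E - (x - eta)%:E)%E.
    rewrite /A lebesgue_measure_itv ifT//= lte_fin; lra.
  by rewrite -EFinB; congr (_%:E); ring.
have mass : 2 * eta * m <= fine (mut A).
  rewrite -lee_fin fineK ?fin_num_measure// fE//.
  apply: (@le_trans _ _ (\int[lebesgue_measure]_(s in A) (m%:E))%E).
    suff -> : (2 * eta * m)%:E = (m%:E * (@lebesgue_measure R) A)%E.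
      by rewrite -(@integral_cst _ _ _ (@lebesgue_measure R)).
    by rewrite lA -EFinM mulrC.
  apply: ge0_le_integral => //.
    by apply/measurable_EFinP; exact: measurable_funTS.
  by move=> s As; rewrite lee_fin mfs// Ad.
have := @markov_square _ _ _ _ muT1 _ (x +i* eta) A (2 * eta) nz dz mA.
set T := square_transform _ _ _ _ => mk.
have /mk : forall s, A s -> `[left_edge mut, right_edge mut]%classic s ->
    normc (x +i* eta - s%:C) <= 2 * eta.
  move=> s /Ad se _; apply: le_trans (normc_le_ReIm _) _ => /=.
  by rewrite subr0 (gtr0_norm eta0) distrC; lra.
have e2 : 0 < (2 * eta) ^+ 2 by rewrite exprn_gt0// mulr_gt0.
rewrite ler_pdivrMr// => up; have := le_trans mass up.
have -> : T * (2 * eta) ^+ 2 = 2 * eta * (2 * eta * T) by ring.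
by rewrite ler_pM2l ?mulr_gt0.
Qed.

End subordinated_density.

Theorem propositionA1 (R : realType) (muD : probability R R) (t : R)
    (t0 : 0 < t) (mut : probability R R) (f : R -> R) :
  compact (msupport muD) ->
  is_free_convolution (semicircle_law t0) muD mut ->
  has_density mut f ->
  continuous f ->
  exists c eps : R, 0 < c /\ 0 < eps /\
    forall x : R, left_edge mut <= x <= left_edge mut + eps ->
      f x <= c * Num.sqrt (x - left_edge mut).
Proof.
move=> cD [cT conv] fd fc.
have bdD := compact_bounded cD; have bdT := compact_bounded cT.
have muT1 := support_itv_full bdT; have muD1 := support_itv_full bdD.
have convl : \forall w \near (0 : R)^'-,
    R_transform mut w = R_transform (semicircle_law t0) w + R_transform muD w.
  case: conv => e /= e0 He; exists e => // w we w0; apply: He => //.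
  by rewrite lt_eqF.
have ninf := subordination_near_infinity bdD bdT convl.
have mass := left_edge_mass bdD.
have lrD := left_le_right bdD.
move: (left_edge muD) (right_edge muD) muD1 ninf mass lrD => aD bD muD1 ninf mass lrD.
have dens := density_le_square_transform bdT fd.
move: (left_edge mut) (right_edge mut) muT1 ninf dens => aT bT muT1 ninf dens.
pose B : R := `|aD| + `|bD|; pose Z : R := `|aT| + 2.
have B0 : 0 <= B by rewrite addr_ge0.
have aT0 : 0 <= `|aT| by [].
pose L : R := Z + 2 * t + 2 * B + 1.
have L0 : 0 < L by rewrite /L /Z; lra.
pose L' : R := `|bD - aT| + 1; have L'0 : 0 < L' by rewrite ltr_wpDl.
pose C : R := 4 * (L ^+ 2 * L') / t ^+ 3.
have C0 : 0 < C by rewrite divr_gt0 ?mulr_gt0 ?exprn_gt0.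
(* The square root law comes from [m ^+ 2 <= C * (x - aT + 2 * eta)] for each
   [m < f x] and each small [eta]. *)
exists (Num.sqrt C), 1; split; first by rewrite sqrtr_gt0.
split=> // x /andP[ax xa]; set S : R := Num.sqrt (x - aT).
have S0 : 0 <= S by exact: sqrtr_ge0.
have SE : S ^+ 2 = x - aT by rewrite sqr_sqrtr// subr_ge0.
have cC : Num.sqrt C ^+ 2 = C by rewrite sqr_sqrtr// ltW.
have c0 : 0 <= Num.sqrt C by exact: sqrtr_ge0.
rewrite leNgt; apply/negP => fx.
pose e := (f x - Num.sqrt C * S) / 2.
have e0 : 0 < e by rewrite /e; lra.
have [d /= d0 fd'] : \forall s \near x, `|f x - f s| < e.
  by apply: (@cvgr_dist_lt _ _ _ _ _ f (f x) (fc x)).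
pose eta := Num.min d (Num.min 1 (e ^+ 2 / (4 * C))).
have eta0 : 0 < eta by rewrite !lt_min d0 ltr01/= divr_gt0 ?exprn_gt0// mulr_gt0.
have etad : eta <= d by rewrite ge_min lexx.
have eta1 : eta <= 1 by rewrite !ge_min lexx orbT.
have etaC : 4 * C * eta <= e ^+ 2.
  have : eta <= e ^+ 2 / (4 * C) by rewrite !ge_min lexx !orbT.
  have c4 : 0 < 4 * C by rewrite mulr_gt0.
  by rewrite ler_pdivlMr// [eta * _]mulrC.
pose m : R := Num.sqrt C * S + e.
have m0 : 0 <= m by apply: addr_ge0; [exact: mulr_ge0|exact: ltW].
have mA := dens x m eta eta0 m0.
have {}mA : m <= 2 * eta * square_transform mut aT bT (x +i* eta).
  apply: mA => s sx; have : `|f x - f s| < e.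
    by apply: fd'; rewrite /= distrC; exact: lt_le_trans etad.
  by move=> /ltr_normlW; rewrite /m /e; lra.
pose z := x +i* eta; have z0 : 0 < Im z by [].
(* Any real point left of the edge and tending to it with eta would do. *)
pose y := aT - eta; have ya : y < aT by rewrite /y; lra.
have Zz : normc z <= Z.
  apply: le_trans (normc_le_ReIm _) _ => /=; rewrite (gtr0_norm eta0) /Z.
  have : `|x| <= `|aT| + 1.
    have := ler_normD aT (x - aT); rewrite addrC subrK => /le_trans; apply.
    by rewrite lerD2l ger0_norm; lra.
  lra.
have xB x' : aD <= x' <= bD -> `|x'| <= B.
  move=> /andP[l r]; rewrite /B ler_norml; apply/andP; split.
    by have := ler_norm (- aD); rewrite normrN; have := normr_ge0 bD; lra.
  by have := ler_norm bD; have := normr_ge0 aD; lra.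
have wL x' : aD <= x' <= bD -> normc (omega mut aT bT t z - x'%:C) <= L.
  exact: (omega_bounded t0 muT1 muD1 ninf z0 Zz xB).
have uL' : bD - omega_real mut t y <= L'.
  have := omega_real_ge t0 muT1 ya; have := ler_norm (bD - aT).
  by rewrite /L' /y; lra.
have main := Im_omega_sqr_le t0 muT1 muD1 mass ninf z0 ya wL uL'.
have zy : normc (z - y%:C) <= S ^+ 2 + 2 * eta.
  apply: le_trans (normc_le_ReIm _) _ => /=.
  by rewrite subr0 (gtr0_norm eta0) SE ger0_norm /y; lra.
have tm : t * m / 2 <= Im (omega mut aT bT t z).
  rewrite (Im_omega t muT1 z0)/=.
  have := ler_wpM2l (ltW t0) mA; rewrite -/z; nra.
have mC : m ^+ 2 <= C * (S ^+ 2 + 2 * eta).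
  have tm0 : 0 <= t * m / 2 by rewrite divr_ge0// mulr_ge0// ltW.
  have sq : (t * m / 2) ^+ 2 <= Im (omega mut aT bT t z) ^+ 2.
    by rewrite lerXn2r// nnegrE// (le_trans tm0).
  have LL : 0 <= L ^+ 2 * L' by rewrite mulr_ge0 ?sqr_ge0 ?(ltW L'0).
  have := le_trans (ler_wpM2l (ltW t0) sq) (le_trans main (ler_wpM2l LL zy)).
  have -> : t * (t * m / 2) ^+ 2 = m ^+ 2 * (t ^+ 3 / 4) by field.
  rewrite -ler_pdivlMr ?divr_gt0 ?exprn_gt0// => /le_trans; apply.
  by rewrite le_eqVlt; apply/orP; left; apply/eqP; rewrite /C; field; rewrite gt_eqF.
move: mC; rewrite /m sqrrD exprMn cC.
have : 0 <= Num.sqrt C * S * e.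
  by apply: mulr_ge0; [exact: mulr_ge0|exact: ltW].
have : 0 < e ^+ 2 by rewrite exprn_gt0.
move: etaC; set r := Num.sqrt C * S * e; nra.
Qed.
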